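(* Let $(R,\mathfrak{m})$ be an excellent Cohen–Macaulay normal local ring of characteristic $p>0$ with perfect residue field, and let $\tau$ be the test ideal of $R$. Let $x_1,\ldots,x_d$ (with $d\ge 2$) be part of a system of parameters of $R$, with $x_1,x_2\in\tau$. Let $I$ be an ideal of $R$ and suppose that $J=(x_1^t,x_2^t,x_3,\ldots,x_d)\subseteq I\subseteq J^*$, where $t\geq 2$. Then $*\text{-}\mathrm{core}(I)=J(J:I)=I(J:I)$.
   Context: Local rings are Noetherian. Let $R$ be a Noetherian ring of characteristic $p>0$; $q$ denotes a power of $p$, and $R^0$ is the set of elements of $R$ not in any minimal prime. For an ideal $I$, $I^{[q]}$ is the ideal generated by the $q$-th powers of elements of $I$. The tight closure $I^*$ of $I$ is the set of $x\in R$ for which there is $c\in R^0$ with $cx^q\in I^{[q]}$ for all large $q$. The test ideal of $R$ is $\tau=\bigcap_{I\subseteq R}(I:I^* )$, the intersection over all ideals $I$ of $R$. An ideal $J\subseteq I$ is a $*$-reduction of $I$ if $J^*=I^*$. The $*$-core of $I$, $*\text{-}\mathrm{core}(I)$, is the intersection of all $*$-reductions of $I$. For ideals $J, I$ of $R$, $(J:I)=\{r\in R: rI\subseteq J\}$. *)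

(* Defs.v *)
From HB Require Import structures.
From mathcomp Require Import all_boot all_order all_algebra.
From mathcomp Require Import boolp classical_sets.

Set Implicit Arguments.
Unset Strict Implicit.
Unset Printing Implicit Defensive.

Import GRing.Theory.
Local Open Scope classical_set_scope.
Local Open Scope ring_scope.

(* All rings below are commutative and nonzero.  In the definitions that       *)
(* quantify over algebras (catenarity, openness of regular loci, regularity of *)
(* fibres) the zero ring would satisfy the requirement vacuously, since it has *)
(* no prime ideal.                                                             *)

Section Ideals.
Variable R : comNzRingType.
Implicit Types (I J P : set R) (s : seq R).

Definition is_ideal I : Prop :=
  [/\ I 0, forall a b, I a -> I b -> I (a + b) & forall r a, I a -> I (r * a)].

Definition ideal_gen (A : set R) : set R := smallest is_ideal A.

Definition ideal_mul I J : set R :=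
  ideal_gen [set a * b | a in I & b in J].

Definition ideal_pow I (n : nat) : set R := iter n (ideal_mul I) setT.

Definition colon J I : set R := [set r | forall a, I a -> J (r * a)].

Definition noetherian : Prop :=
  forall I, is_ideal I -> exists s, I = ideal_gen [set` s].

Definition is_prime P : Prop :=
  [/\ is_ideal P, ~ P 1 & forall a b, P (a * b) -> P a \/ P b].

Definition is_minimal_prime P : Prop :=
  is_prime P /\ forall Q, is_prime Q -> Q `<=` P -> Q = P.

Definition is_maximal I : Prop :=
  [/\ is_ideal I, ~ I 1 &
      forall J, is_ideal J -> ~ J 1 -> I `<=` J -> J = I].

Definition is_local (m : set R) : Prop :=
  is_maximal m /\ forall M, is_maximal M -> M = m.

(* A chain c 0 < c 1 < ... < c n of primes has length n. *)
Definition prime_chain (n : nat) (c : nat -> set R) : Prop :=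
  (forall i, (i <= n)%N -> is_prime (c i)) /\
  (forall i, (i < n)%N -> c i `<` c i.+1).

Definition saturated_chain (n : nat) (c : nat -> set R) : Prop :=
  prime_chain n c /\
  forall i Q, (i < n)%N -> is_prime Q -> c i `<` Q -> ~ (Q `<` c i.+1).

Definition catenary : Prop :=
  forall P Q, is_prime P -> is_prime Q -> P `<=` Q ->
  exists n, (exists c, [/\ saturated_chain n c, c 0%N = P & c n = Q]) /\
    (forall k c, saturated_chain k c -> c 0%N = P -> c k = Q -> k = n).

Definition krull_dim (n : nat) : Prop :=
  (exists c, prime_chain n c) /\
  (forall k c, prime_chain k c -> (k <= n)%N).

Definition regular_sequence s : Prop :=
  (forall i, (i < size s)%N -> forall a,
     ideal_gen [set` take i s] (a * s`_i) -> ideal_gen [set` take i s] a) /\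
  ~ ideal_gen [set` s] 1.

Definition depth (m : set R) (n : nat) : Prop :=
  (exists s, [/\ size s = n, [set` s] `<=` m & regular_sequence s]) /\
  (forall s, [set` s] `<=` m -> regular_sequence s -> (size s <= n)%N).

Definition cohen_macaulay_local (m : set R) : Prop :=
  exists n, krull_dim n /\ depth m n.

Definition regular_local : Prop :=
  noetherian /\ exists m s,
    [/\ is_local m, krull_dim (size s) & m = ideal_gen [set` s]].

Definition system_of_parameters (m : set R) s : Prop :=
  [/\ krull_dim (size s), [set` s] `<=` m &
      forall a, m a -> exists k, ideal_gen [set` s] (a ^+ k)].

Definition part_of_system_of_parameters (m : set R) s : Prop :=
  exists s', system_of_parameters m (s ++ s').

End Ideals.

Arguments noetherian R : clear implicits.
Arguments catenary R : clear implicits.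
Arguments krull_dim R n : clear implicits.
Arguments regular_local R : clear implicits.

(* Localizations, residue fields, completions and tensor products are          *)
(* described by predicates on ring morphisms that determine them up to unique  *)
(* isomorphism.                                                                *)

Definition is_localization (R L : comNzRingType) (P : set R)
    (f : {rmorphism R -> L}) : Prop :=
  [/\ forall s, ~ P s -> exists u, u * f s = 1,
      forall y, exists a s, ~ P s /\ y * f s = f a &
      forall a, f a = 0 -> exists s, ~ P s /\ s * a = 0].

(* K = Frac (R / P); when P is maximal, this is R / P. *)
Definition is_residue_field (R : comNzRingType) (K : fieldType) (P : set R)
    (f : {rmorphism R -> K}) : Prop :=
  (forall a, f a = 0 <-> P a) /\
  (forall y, exists a s, ~ P s /\ y = f a / f s).

(* C is complete and separated for the topology of the extended ideal mC, and  *)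
(* A / m ^ n -> C / (mC) ^ n is bijective for all n; when m is finitely        *)
(* generated this says that C is the inverse limit of the A / m ^ n.           *)
Definition is_completion (A C : comNzRingType) (m : set A)
    (g : {rmorphism A -> C}) : Prop :=
  let mC := ideal_gen (g @` m) in
  [/\ forall n a, ideal_pow mC n (g a) -> ideal_pow m n a,
      forall n y, exists a, ideal_pow mC n (y - g a),
      forall y, (forall n, ideal_pow mC n y) -> y = 0 &
      forall u : nat -> C, (forall n, ideal_pow mC n (u n.+1 - u n)) ->
        exists l, forall n, ideal_pow mC n (u n - l)].

(* T is the tensor product of B and C over A, as a pushout of rings. *)
Definition is_tensor_product (A B C T : comNzRingType)
    (f : {rmorphism A -> B}) (g : {rmorphism A -> C})
    (i : {rmorphism B -> T}) (j : {rmorphism C -> T}) : Prop :=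
  (forall a, i (f a) = j (g a)) /\
  forall (D : comNzRingType) (u : {rmorphism B -> D}) (v : {rmorphism C -> D}),
    (forall a, u (f a) = v (g a)) ->
    exists h : {rmorphism T -> D},
      [/\ forall b, h (i b) = u b, forall c, h (j c) = v c &
          forall h' : {rmorphism T -> D}, (forall b, h' (i b) = u b) ->
            (forall c, h' (j c) = v c) -> forall y, h' y = h y].

Definition finite_extension (K L : fieldType) (h : {rmorphism K -> L}) : Prop :=
  exists n (b : 'I_n -> L), forall y, exists c : 'I_n -> K,
    y = \sum_(i < n) h (c i) * b i.

Definition finite_type_algebra (R S : comNzRingType)
    (f : {rmorphism R -> S}) : Prop :=
  exists s : seq S,
    smallest (fun A : set S => subring_closed [in A]) (range f `|` [set` s])
    = setT.

Definition regular_at (R : comNzRingType) (P : set R) : Prop :=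
  forall (L : comNzRingType) (f : {rmorphism R -> L}),
    is_localization P f -> regular_local L.

Definition regular_ring (R : comNzRingType) : Prop :=
  noetherian R /\ forall P : set R, is_prime P -> regular_at P.

(* Openness in the Zariski topology: the complement of some V(I). *)
Definition open_regular_locus (R : comNzRingType) : Prop :=
  exists2 I : set R, is_ideal I &
    forall P : set R, is_prime P -> (regular_at P <-> ~ I `<=` P).

(* The fibres of g : A -> C are geometrically regular: C (x)_A L is regular    *)
(* for every finite extension L of every residue field K of A.                 *)
Definition geometrically_regular_fibres (A C : comNzRingType)
    (g : {rmorphism A -> C}) : Prop :=
  forall (P : set A) (K L : fieldType) (k : {rmorphism A -> K})
         (h : {rmorphism K -> L}),
    is_prime P -> is_residue_field P k -> finite_extension h ->
  forall (T : comNzRingType) (i : {rmorphism C -> T}) (j : {rmorphism L -> T}),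
    is_tensor_product g (h \o k : {rmorphism A -> L}) i j -> regular_ring T.

Definition G_ring (R : comNzRingType) : Prop :=
  noetherian R /\
  forall (P : set R) (A C : comNzRingType)
         (f : {rmorphism R -> A}) (m : set A) (g : {rmorphism A -> C}),
    is_prime P -> is_localization P f -> is_local m -> is_completion m g ->
    geometrically_regular_fibres g.

Definition J2_ring (R : comNzRingType) : Prop :=
  noetherian R /\
  forall (S : comNzRingType) (f : {rmorphism R -> S}),
    finite_type_algebra f -> open_regular_locus S.

Definition universally_catenary (R : comNzRingType) : Prop :=
  noetherian R /\
  forall (S : comNzRingType) (f : {rmorphism R -> S}),
    finite_type_algebra f -> catenary S.

Definition excellent (R : comNzRingType) : Prop :=
  [/\ noetherian R, universally_catenary R, G_ring R & J2_ring R].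

(* A ring that embeds in a field with every nonzero element becoming           *)
(* invertible is a domain, so the existence of K forces R to be one.           *)
Definition integrally_closed_domain (R : comNzRingType) : Prop :=
  exists (K : fieldType) (f : {rmorphism R -> K}),
    is_localization [set 0] f /\
    forall u : K, integralOver f u -> exists r, u = f r.

Definition normal_ring (R : comNzRingType) : Prop :=
  forall (P : set R) (L : comNzRingType) (f : {rmorphism R -> L}),
    is_prime P -> is_localization P f -> integrally_closed_domain L.

Definition perfect_field (K : fieldType) : Prop :=
  forall p, p \in [pchar K] -> forall a : K, exists b : K, b ^+ p = a.

Section TightClosure.
Variables (R : comNzRingType) (p : nat).
Implicit Types I J : set R.

(* The set usually denoted R^0. *)
Definition off_minimal_primes : set R :=
  [set c | forall P, is_minimal_prime P -> ~ P c].

Definition frobenius_power I (q : nat) : set R :=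
  ideal_gen [set a ^+ q | a in I].

Definition tight_closure I : set R :=
  [set x | exists2 c, off_minimal_primes c &
     exists N, forall e, (N <= e)%N ->
       frobenius_power I (p ^ e) (c * x ^+ (p ^ e))].

Definition test_ideal : set R :=
  \bigcap_(I in [set I : set R | is_ideal I]) colon I (tight_closure I).

Definition star_reduction I J : Prop :=
  [/\ is_ideal J, J `<=` I & tight_closure J = tight_closure I].

Definition star_core I : set R :=
  \bigcap_(J in [set J : set R | star_reduction I J]) J.

End TightClosure.

(* Main.v *)
Require Import Defs.
From HB Require Import structures.
From mathcomp Require Import all_boot all_order all_algebra.
From mathcomp Require Import boolp classical_sets.
From mathcomp Require Import ring.

Set Implicit Arguments.
Unset Strict Implicit.
Unset Printing Implicit Defensive.

Import GRing.Theory.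
Local Open Scope classical_set_scope.
Local Open Scope ring_scope.

(** Let [x_0] and [x_1] be the first two parameters, [K] the ideal generated by all
    parameters, [w = (x_0 x_1)^(t-1)], and [f_j] the given generators of [J]. Since
    [R] is Cohen-Macaulay, powers of the parameters behave like powers of variables:
    [(J : w) = K], [(J : (x_0, x_1)) = J + (w)], and similarly for Frobenius powers.

    As [x_0] and [x_1] are test elements, they multiply [I] into [J], whence
    [I = J + w B] with [B = {b | w b in I}], and [(J : I) = (K : B)]. Moreover
    [B] is contained in [K^*], hence in the maximal ideal. The main identity is
    [w x_j = z_j h_j f_j], where [z_j] is [x_0] or [x_1]; this factor exists
    because [t >= 2]. It shows that [w K] is contained in [J (J : I)], and the
    equality [I (J : I) = J (J : I)] follows (lemma [ideal_mul_colon_eq]). It also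
    shows that the elements [w b], for [b] in [B], are negligible in [J^*]: the
    product of [w^q b^q] with a test element is a combination of the [f_j^q] with
    coefficients in the Frobenius power [m^[q]] (lemma [special_combination]).

    The core is contained in [J (J : I)]. Adding [w b] to a single generator
    [f_i] gives another reduction of [I]: with the multiplier [z_i], the
    coefficient of [f_i^q] changes only by a unit (lemma [perturbed_reduction]).
    An element [y] that belongs to [J] and to all these reductions has coefficients
    on the [f_i] that multiply every [b] into [K], so they lie in [(J : I)]
    (lemma [star_core_sub_JC]).

    Conversely, let [L] be a reduction. Its generators are combinations of the
    [f_j] up to elements of [w B]. If their coordinates did not span modulo [m],
    a fixed nonzero multiplier would belong to [m^[q]] for all large [q], against
    Krull's intersection theorem (lemma [reduction_coordinates_free]). So [L]
    contains elements [f_j + w b_j], one for each [j]. Eliminating with the main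
    identity gives [w K] inside [L], the elimination being possible because the
    [b_j] are in [m], and then [J (J : I)] inside [L] (lemma [JC_sub_reduction]).

    The Cohen-Macaulay property enters through the theorem [parameters_regular],
    proved by exchanging the terms of a regular sequence of maximal length for
    parameters, with prime avoidance and Krull's intersection theorem. *)

(** * Ideals given by finitely many generators *)

Section IdealBasics.
Variable R : comNzRingType.
Implicit Types (A I J : set R).

Lemma ideal0 A : is_ideal A -> A 0. Proof. by case. Qed.

Lemma idealD A : is_ideal A -> forall a b, A a -> A b -> A (a + b).
Proof. by case. Qed.

Lemma idealMl A : is_ideal A -> forall r a, A a -> A (r * a).
Proof. by case. Qed.

Lemma idealMr A : is_ideal A -> forall r a, A a -> A (a * r).
Proof. by move=> iA r a Aa; rewrite mulrC; apply: idealMl. Qed.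

Lemma idealN A : is_ideal A -> forall a, A a -> A (- a).
Proof. by move=> iA a Aa; rewrite -mulN1r; apply: idealMl. Qed.

Lemma idealB A : is_ideal A -> forall a b, A a -> A b -> A (a - b).
Proof. by move=> iA a b Aa Ab; apply: idealD => //; apply: idealN. Qed.

Lemma idealX A : is_ideal A -> forall a n, A a -> (0 < n)%N -> A (a ^+ n).
Proof. by move=> iA a [//|n] Aa _; rewrite exprS; apply: idealMr. Qed.

Lemma ideal_addl A : is_ideal A -> forall a b, A b -> A (a + b) -> A a.
Proof. by move=> iA a b Ab Aab; rewrite -(addrK b a); apply: idealB. Qed.

Lemma ideal_addr A : is_ideal A -> forall a b, A a -> A (a + b) -> A b.
Proof. by move=> iA a b Aa; rewrite addrC; apply: ideal_addl. Qed.

Lemma ideal_sum A (T : Type) (s : seq T) (P : pred T) (F : T -> R) :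
  is_ideal A -> (forall i, P i -> A (F i)) -> A (\sum_(i <- s | P i) F i).
Proof. by move=> iA AF; apply: big_ind => //; [case: iA | case: iA]. Qed.

Lemma ideal_gen_ideal (G : set R) : is_ideal (ideal_gen G).
Proof.
split=> [A [iA _]|a b Ga Gb A AG|r a Ga A AG]; first by case: iA.
- by case: (AG) => iA _; apply: idealD => //; [apply: Ga | apply: Gb].
- by case: (AG) => iA _; apply: idealMl => //; apply: Ga.
Qed.

Lemma mem_ideal_gen (G : set R) a : G a -> ideal_gen G a.
Proof. exact: sub_gen_smallest. Qed.

Lemma ideal_gen_min A (G : set R) :
  is_ideal A -> G `<=` A -> ideal_gen G `<=` A.
Proof. exact: smallest_sub. Qed.

Lemma is_ideal0 : is_ideal ([set 0] : set R).
Proof.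
by split=> [|a b -> ->|r a ->] //=; rewrite ?addr0 ?mulr0.
Qed.

Definition span (T : finType) (P : pred T) (g : T -> R) : set R :=
  [set y | exists r : T -> R, y = \sum_(i | P i) r i * g i].

Section Span.
Variables (T : finType) (g : T -> R).
Implicit Type P : pred T.

Lemma span_ideal P : is_ideal (span P g).
Proof.
split=> [|a b [r ->] [s ->]|c a [r ->]].
- by exists (fun=> 0); rewrite big1 // => i _; rewrite mul0r.
- exists (fun i => r i + s i); rewrite -big_split /=.
  by apply: eq_bigr => i _; rewrite mulrDl.
- exists (fun i => c * r i); rewrite mulr_sumr.
  by apply: eq_bigr => i _; rewrite mulrA.
Qed.

Lemma mem_span P i : P i -> span P g (g i).
Proof.
move=> Pi; exists (fun j => (j == i)%:R).
rewrite (bigD1 i) //= eqxx mul1r big1 ?addr0 // => j /andP[_ /negbTE ->].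
by rewrite mul0r.
Qed.

Lemma span_sub P A :
  is_ideal A -> (forall i, P i -> A (g i)) -> span P g `<=` A.
Proof.
by move=> iA Ag _ [r ->]; apply: ideal_sum => // i Pi; apply: idealMl; auto.
Qed.

Lemma ideal_gen_span P (G : set R) :
  (forall i, P i -> G (g i)) -> (forall y, G y -> exists2 i, P i & y = g i) ->
  ideal_gen G = span P g.
Proof.
move=> gG Gg; apply/seteqP; split.
  apply: ideal_gen_min => [|y /Gg[i Pi ->]]; first exact: span_ideal.
  exact: mem_span.
apply: span_sub; first exact: ideal_gen_ideal.
by move=> i /gG; apply: mem_ideal_gen.
Qed.

Lemma span_addD P i y : P i ->
  span P g y <-> exists v, span (fun j => P j && (j != i)) g (y - v * g i).
Proof.
move=> Pi; split=> [[r ->]|[v [r]]].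
  by exists (r i), r; rewrite (bigD1 i) //= addrC addrK.
move/(canRL (subrK _)) => ->; apply: idealD.
- exact: span_ideal.
- apply: (@span_sub (fun j => P j && (j != i)) _ (span_ideal P)).
    by move=> j /andP[Pj _]; exact: mem_span.
  by exists r.
- by apply: idealMl; [exact: span_ideal | exact: mem_span].
Qed.

End Span.

Lemma noetherian_span A : noetherian R -> is_ideal A ->
  exists n (g : 'I_n -> R), A = span xpredT g.
Proof.
move=> noeth /noeth[s ->]; exists (size s), (fun i => s`_i).
apply: ideal_gen_span => [i _|y /=]; first exact: mem_nth.
by case/(nthP 0) => i lti <-; exists (Ordinal lti).
Qed.

(** The ascending chain condition, in the form of the maximal condition, since
    the union of a strictly increasing sequence would need infinitely many
    generators. *)
Lemma noetherian_max (F : set (set R)) : noetherian R ->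
    (forall A, F A -> is_ideal A) -> forall A0, F A0 ->
  exists M, [/\ F M, A0 `<=` M & forall B, F B -> M `<=` B -> B = M].
Proof.
move=> noeth Fid A0 FA0; apply: contrapT => noM.
pose G : set (set R) := [set A | F A /\ A0 `<=` A].
have /choice[nx nxP] (A : set R) :
    exists B, G A -> [/\ G B, A `<=` B & ~ B `<=` A].
  case: (pselect (G A)) => [[FA A0A]|nGA]; last by exists A => /nGA.
  apply: contrapT => noB; apply: noM; exists A; split=> // B FB AB.
  apply/seteqP; split=> //; apply: contrapT => nBA; apply: noB.
  by exists B; split=> //; split=> //; apply: subset_trans AB.
pose c n := iter n nx A0.
have cG n : G (c n) by elim: n => [|n IH]; [split | case: (nxP _ IH)].
have cS n : c n `<=` c n.+1 by case: (nxP _ (cG n)).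
have cmono i j : (i <= j)%N -> c i `<=` c j.
  move/subnK <-; elim: (j - i)%N => [|k IH]; first exact: subset_refl.
  exact: subset_trans IH (cS _).
pose U : set R := [set x | exists n, c n x].
have iU : is_ideal U.
  split=> [|a b [i ca] [j cb]|r a [i ca]].
  - by exists 0%N; apply: ideal0; exact: Fid.
  - exists (maxn i j); apply: idealD.
    + by apply: Fid; case: (cG (maxn i j)).
    + exact: cmono (leq_maxl i j) _ ca.
    + exact: cmono (leq_maxr i j) _ cb.
  - by exists i; apply: idealMl => //; apply: Fid; case: (cG i).
have [n [g Ug]] := noetherian_span noeth iU.
have /choice[k kP] i : exists k, c k (g i).
  by have: U (g i) by rewrite Ug; exact: mem_span.
pose N := (\max_(i < n) k i)%N.
case: (nxP _ (cG N)) => _ _; apply.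
apply: (@subset_trans _ U); first by move=> x cx; exists N.+1.
rewrite Ug; apply: span_sub; first by apply: Fid; case: (cG N).
by move=> i _; apply: cmono (kP i); exact: (leq_bigmax i).
Qed.

End IdealBasics.

(** * Frobenius powers *)

Section Frobenius.
Variables (R : comNzRingType) (p : nat).
Hypothesis Rchar : p \in [pchar R].

Lemma pchar_prime : prime p. Proof. exact: pcharf_prime Rchar. Qed.

Lemma expr_pchar_gt0 e : (0 < p ^ e)%N.
Proof. by rewrite expn_gt0 prime_gt0 ?pchar_prime. Qed.

Lemma expr_pchar_leq k e : (k <= e)%N -> (k <= p ^ e)%N.
Proof.
by move=> ke; apply: leq_trans ke _; apply/ltnW/ltn_expl/prime_gt1/pchar_prime.
Qed.

Lemma exprD_pchar e (a b : R) :
  (a + b) ^+ (p ^ e) = a ^+ (p ^ e) + b ^+ (p ^ e).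
Proof.
apply: exprDn_pchar.
by rewrite pnatX (eq_pnat _ (pcharf_eq Rchar)) pnat_id ?pchar_prime.
Qed.

Lemma expr_sum_pchar e (T : Type) (s : seq T) (P : pred T) (F : T -> R) :
  (\sum_(i <- s | P i) F i) ^+ (p ^ e) = \sum_(i <- s | P i) F i ^+ (p ^ e).
Proof.
apply: (big_morph (fun a : R => a ^+ (p ^ e))); first exact: exprD_pchar.
by rewrite expr0n -[_ == _]negbK -lt0n expr_pchar_gt0.
Qed.

Lemma mem_frobenius_power (A : set R) n a : A a -> frobenius_power A n (a ^+ n).
Proof. by move=> Aa; apply: mem_ideal_gen; exists a. Qed.

Lemma frobenius_power_ideal (A : set R) n : is_ideal (frobenius_power A n).
Proof. exact: ideal_gen_ideal. Qed.

Lemma frobenius_power_span (T : finType) (P : pred T) (g : T -> R) e :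
  frobenius_power (span P g) (p ^ e) = span P (fun i => g i ^+ (p ^ e)).
Proof.
apply/seteqP; split; last first.
  apply: span_sub; first exact: frobenius_power_ideal.
  by move=> i Pi; apply: mem_frobenius_power; exact: mem_span.
apply: ideal_gen_min => [|_ [_ [r ->] <-]]; first exact: span_ideal.
exists (fun i => r i ^+ (p ^ e)); rewrite expr_sum_pchar.
by apply: eq_bigr => i _; rewrite exprMn.
Qed.

End Frobenius.

Arguments mem_frobenius_power {R A} n {a} _.

(** * Local rings *)

Definition adjoin (R : comNzRingType) (A : set R) (a : R) : set R :=
  [set y | exists r, A (y - r * a)].

Section Adjoin.
Variable R : comNzRingType.
Implicit Types (A B : set R).

Lemma adjoin_ideal A a : is_ideal A -> is_ideal (adjoin A a).
Proof.
move=> iA; split=> [|y z [r Ar] [s As]|c y [r Ar]].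
- by exists 0; rewrite mul0r subr0; apply: ideal0.
- by exists (r + s); rewrite mulrDl opprD addrACA; apply: idealD.
- by exists (c * r); rewrite -mulrA -mulrBr; apply: idealMl.
Qed.

Lemma sub_adjoin A a : A `<=` adjoin A a.
Proof. by move=> y Ay; exists 0; rewrite mul0r subr0. Qed.

Lemma mem_adjoin A a : is_ideal A -> adjoin A a a.
Proof. by move=> iA; exists 1; rewrite mul1r subrr; apply: ideal0. Qed.

Lemma adjoin_min A B a : is_ideal B -> A `<=` B -> B a -> adjoin A a `<=` B.
Proof.
move=> iB AB Ba y [r /AB Br]; rewrite -(subrK (r * a) y).
by apply: idealD => //; apply: idealMl.
Qed.

End Adjoin.

Section LocalRing.
Variables (R : comNzRingType) (m : set R).
Hypotheses (noeth : noetherian R) (Rlocal : is_local m).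

Lemma maximal_ideal : is_ideal m. Proof. by case: Rlocal => -[]. Qed.

Lemma maximal_not1 : ~ m 1. Proof. by case: Rlocal => -[]. Qed.

Lemma local_unit r : ~ m r -> exists u, u * r = 1.
Proof.
move=> nmr; apply: contrapT => nu; pose A := adjoin [set 0] r.
have iA : is_ideal A by apply: adjoin_ideal; exact: is_ideal0.
have A1 : ~ A 1 by case=> u /subr0_eq e; apply: nu; exists u.
have [M [[iM M1] AM Mmax]] := noetherian_max
  (F := [set A | is_ideal A /\ ~ A 1]) noeth (fun _ => @proj1 _ _)
  (conj iA A1).
have : M = m.
  by case: Rlocal => _; apply; split=> // B iB B1 MB; apply: Mmax.
move=> eM; apply: nmr; rewrite -eM; apply: AM; apply: mem_adjoin.
exact: is_ideal0.
Qed.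

Lemma local_unit1B a : m a -> exists u, u * (1 - a) = 1.
Proof.
move=> ma; apply: local_unit => m1a; apply: maximal_not1.
by rewrite -(subrK a 1); apply: idealD => //; exact: maximal_ideal.
Qed.

Lemma ideal_unit (A : set R) a z : is_ideal A -> m a -> A ((1 - a) * z) -> A z.
Proof.
move=> iA /local_unit1B[u ue] Az; rewrite -(mul1r z) -ue -mulrA.
exact: idealMl.
Qed.

Variable p : nat.
Hypothesis Rchar : p \in [pchar R].

(** Krull's intersection theorem modulo an ideal [A].  If [z] were outside [A],
    an ideal [H] containing [A] and [m z] and maximal among those avoiding [z]
    would contain a power of every element of [m]: once the chain of ideals
    [(H : a ^ n)] is stationary, [H + (a ^ n)] still avoids [z].  Hence [H]
    contains some Frobenius power of [m], and with it [z]. *)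
Lemma krull_intersection (A : set R) z : is_ideal A ->
  (forall e0, exists2 e, (e0 <= e)%N &
     exists2 y, frobenius_power m (p ^ e) y & A (z - y)) -> A z.
Proof.
move=> iA zA; apply: contrapT => nAz; have im := maximal_ideal.
pose F : set (set R) := [set H | [/\ is_ideal H, A `<=` H, ~ H z &
  forall a, m a -> H (a * z)]].
pose A0 : set R := [set y | exists2 a, m a & A (y - a * z)].
have FA0 : F A0.
  split.
  - split=> [|a b [r mr Ar] [s ms As]|c a [r mr Ar]].
    + by exists 0; [exact: ideal0 | rewrite mul0r subr0; exact: ideal0].
    + exists (r + s); first exact: idealD.
      by rewrite mulrDl opprD addrACA; exact: idealD.
    + exists (c * r); first exact: idealMl.
      by rewrite -mulrA -mulrBr; exact: idealMl.
  - by move=> a Aa; exists 0; [exact: ideal0 | rewrite mul0r subr0].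
  - by case=> a ma; rewrite -{1}(mul1r z) -mulrBl => /(ideal_unit iA ma).
  - by move=> a ma; exists a => //; rewrite subrr; exact: ideal0.
have [H [[iH AH nHz mzH] _ Hmax]] :=
  noetherian_max noeth (fun B (FB : F B) => let: And4 i _ _ _ := FB in i) FA0.
have Hpow a : m a -> exists n, H (a ^+ n).
  move=> ma; pose C n : set R := [set r | H (a ^+ n * r)].
  have iC n : is_ideal (C n).
    split=> [|x y Cx Cy|r x Cx]; rewrite /C /=.
    - by rewrite mulr0; exact: ideal0.
    - by rewrite mulrDr; exact: idealD.
    - by rewrite mulrCA; exact: idealMl.
  have [_ [[n ->] _ Cmax]] := noetherian_max (F := [set B | exists n, B = C n])
    noeth (fun B (FB : exists n, B = C n) =>
             let: ex_intro n e := FB in eq_ind_r (@is_ideal R) (iC n) e)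
    (ex_intro _ 0%N erefl).
  have CS : C n.+1 = C n.
    apply: Cmax => [|r Cr]; first by exists n.+1.
    by rewrite /C /= exprS -mulrA; exact: idealMl.
  exists n; suff -> : H = adjoin H (a ^+ n) by exact: mem_adjoin.
  apply/esym/Hmax; last exact: sub_adjoin.
  split; first exact: adjoin_ideal.
  - exact: subset_trans AH (sub_adjoin _).
  - case=> s Hzs; apply: nHz; apply: (ideal_addl iH _ Hzs).
    apply: idealN => //; rewrite mulrC; change (C n s); rewrite -CS /C /= exprSr.
    rewrite -mulrA; have := idealMl iH a Hzs; rewrite mulrBr.
    move/(ideal_addr iH (mzH _ ma))/(idealN iH); rewrite opprK.
    by congr (H _); ring.
  - by move=> b mb; apply: sub_adjoin; exact: mzH.
have [n [g mg]] := noetherian_span noeth im.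
have /choice[k kP] i : exists k, H (g i ^+ k).
  by apply: Hpow; rewrite mg; exact: mem_span.
have [e le_e [y my Azy]] := zA (\max_(i < n) k i)%N.
apply: nHz; rewrite -(subrK y z); apply: idealD => //; first exact: AH.
move: my; rewrite mg frobenius_power_span //; apply: span_sub => // i _.
have le_ki : (k i <= p ^ e)%N.
  apply: (expr_pchar_leq Rchar); apply: leq_trans le_e.
  exact: (leq_bigmax i).
by rewrite -(subnK le_ki) exprD; exact: idealMl.
Qed.

End LocalRing.

(** * Regular sequences modulo an ideal *)

Definition nzd (R : comNzRingType) (A : set R) (a : R) : Prop :=
  forall r, A (a * r) -> A r.

Definition adjoins (R : comNzRingType) (A : set R) (s : seq R) : set R :=
  foldl (@adjoin R) A s.

(** Working modulo an arbitrary ideal replaces the passage to quotient rings in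
    inductions on the length of the sequence. *)
Fixpoint regular_mod (R : comNzRingType) (A : set R) (s : seq R) : Prop :=
  if s is a :: s' then nzd A a /\ regular_mod (adjoin A a) s' else True.

Section Adjoins.
Variable R : comNzRingType.
Implicit Types (A B : set R) (s : seq R).

Lemma adjoins_ideal A s : is_ideal A -> is_ideal (adjoins A s).
Proof. by elim: s A => //= a s IH A iA; apply/IH/adjoin_ideal. Qed.

Lemma sub_adjoins A s : A `<=` adjoins A s.
Proof.
elim: s A => [A|a s IH A]; first exact: subset_refl.
exact: subset_trans (@sub_adjoin _ _ a) (IH _).
Qed.

Lemma mem_adjoins A s a : is_ideal A -> a \in s -> adjoins A s a.
Proof.
elim: s A => // b s IH A iA; rewrite inE => /orP[/eqP -> /=|]; last first.
  by apply: IH; exact: adjoin_ideal.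
by apply: sub_adjoins; exact: mem_adjoin.
Qed.

Lemma adjoins_min A B s : is_ideal B -> A `<=` B ->
  (forall a, a \in s -> B a) -> adjoins A s `<=` B.
Proof.
move=> iB; elim: s A => //= a s IH A AB sB; apply: IH => [|b sb].
  by apply: adjoin_min => //; apply: sB; exact: mem_head.
by apply: sB; rewrite inE sb orbT.
Qed.

Lemma adjoins_mono A B s t : is_ideal B -> A `<=` adjoins B t ->
  (forall a, a \in s -> adjoins B t a) -> adjoins A s `<=` adjoins B t.
Proof. by move=> iB; apply: adjoins_min; exact: adjoins_ideal. Qed.

Lemma adjoins_perm A s t : is_ideal A -> s =i t -> adjoins A s = adjoins A t.
Proof.
move=> iA st; apply/seteqP; split; apply: adjoins_mono => //.
- exact: sub_adjoins.
- by move=> a; rewrite st; apply: mem_adjoins.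
- exact: sub_adjoins.
- by move=> a; rewrite -st; apply: mem_adjoins.
Qed.

Lemma ideal_gen_adjoins s : ideal_gen [set` s] = adjoins [set 0] s.
Proof.
apply/seteqP; split.
  apply: ideal_gen_min => [|a]; first by apply: adjoins_ideal; exact: is_ideal0.
  by apply: mem_adjoins; exact: is_ideal0.
apply: adjoins_min => [|_ ->|]; [exact: ideal_gen_ideal | |exact: mem_ideal_gen].
by apply: ideal0; exact: ideal_gen_ideal.
Qed.

Lemma regular_mod_cat A s t :
  regular_mod A (s ++ t) <-> regular_mod A s /\ regular_mod (adjoins A s) t.
Proof.
elim: s A => [|a s IH] A /=; first by split=> // -[].
split=> [[na /IH[]]|[[na rs] rt]] //; split=> //; exact/IH.
Qed.

Lemma regular_modP A s :
  (forall i, (i < size s)%N -> nzd (adjoins A (take i s)) s`_i) ->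
  regular_mod A s.
Proof.
elim: s A => //= a s IH A nz; split; first exact: (nz 0%N).
by apply: IH => i lti; exact: (nz i.+1).
Qed.

Lemma nzd_congr A a b : is_ideal A -> A (a - b) -> nzd A a -> nzd A b.
Proof.
move=> iA Aab na r Abr; apply: na; rewrite -(subrK b a) mulrDl.
by apply: idealD => //; apply: idealMr.
Qed.

End Adjoins.

Section RegularSequences.
Variables (R : comNzRingType) (m : set R) (p : nat).
Hypotheses (noeth : noetherian R) (Rlocal : is_local m).
Hypothesis Rchar : p \in [pchar R].
Implicit Types (A B : set R) (s : seq R).

(** The annihilator of [b] modulo [A] is contained in [a] times itself plus
    [A], hence in [A] by the intersection theorem. *)
Lemma regular_mod_swap A a b s : is_ideal A -> m a ->
  regular_mod A (a :: b :: s) -> regular_mod A (b :: a :: s).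
Proof.
move=> iA ma [na [nb rs]]; split; last split.
- pose N : set R := [set z | A (b * z)].
  have step z : N z -> exists2 z', N z' & A (z - a * z').
    move=> Nz; have [z' Az'] := nb z (sub_adjoin _ (Nz : A (b * z))).
    exists z'; last by rewrite mulrC.
    apply: na; have := idealMl iA b Az'; rewrite mulrBr => /(ideal_addr iA Nz).
    by move/(idealN iA); rewrite opprK; congr (A _); ring.
  have iter_step n z : N z -> exists z', A (z - a ^+ n * z').
    elim: n z => [z _|n IH z /step[z1 /IH[z2 Az2] Az1]].
      by exists z; rewrite expr0 mul1r subrr; exact: ideal0.
    exists z2; rewrite exprS.
    have -> : z - a * a ^+ n * z2 = (z - a * z1) + a * (z1 - a ^+ n * z2) by ring.
    by apply: idealD => //; exact: idealMl.
  move=> z Nz; apply: (krull_intersection noeth Rlocal Rchar iA) => e0.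
  exists e0 => //; have [z' Az'] := iter_step (p ^ e0)%N z Nz.
  exists (a ^+ (p ^ e0) * z') => //.
  exact: (idealMr (frobenius_power_ideal _ _) _ (mem_frobenius_power _ ma)).
- move=> r [c Ac]; have [|d Ad] := nb c.
    exists r; have := idealN iA Ac; congr (A _); ring.
  exists d; apply: na; have := idealD iA Ac (idealMl iA b Ad).
  congr (A _); ring.
- have -> : adjoin (adjoin A b) a = adjoin (adjoin A a) b; last by [].
  rewrite -[LHS]/(adjoins A [:: b; a]) -[RHS]/(adjoins A [:: a; b]).
  by apply: adjoins_perm => // c; rewrite !inE orbC.
Qed.

Lemma regular_mod_rcons A a s : is_ideal A -> m a ->
  regular_mod A (a :: s) -> regular_mod A (rcons s a).
Proof.
elim: s A => // b s IH A iA ma /(regular_mod_swap iA ma)[nb ras].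
by split=> //; apply: IH => //; exact: adjoin_ideal.
Qed.

Lemma regular_mod_cons A a s : is_ideal A -> (forall b, b \in s -> m b) ->
  regular_mod A (rcons s a) -> regular_mod A (a :: s).
Proof.
elim: s A => // b s IH A iA ms [nb /IH ras].
apply: regular_mod_swap => //; first by apply: ms; exact: mem_head.
split=> //; apply: ras; first exact: adjoin_ideal.
by move=> c sc; apply: ms; rewrite inE sc orbT.
Qed.

Definition ann A (z : R) : set R := [set a | A (a * z)].

Definition max_ann A z : Prop :=
  ~ A z /\ forall z', ~ A z' -> ann A z `<=` ann A z' -> ann A z' = ann A z.

Lemma ann_ideal A z : is_ideal A -> is_ideal (ann A z).
Proof.
move=> iA; split=> [|a b Aa Ab|r a Aa]; rewrite /ann /=.
- by rewrite mul0r; exact: ideal0.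
- by rewrite mulrDl; exact: idealD.
- by rewrite -mulrA; exact: idealMl.
Qed.

Lemma max_ann_prime A z : is_ideal A -> max_ann A z -> is_prime (ann A z).
Proof.
move=> iA [nAz zmax]; split; first exact: ann_ideal.
  by rewrite /ann /= mul1r.
move=> a b Aab; case: (pselect (ann A z b)) => [|nb]; [by right | left].
rewrite -(zmax (b * z)) => [|//|c]; first by rewrite /ann /= mulrA.
by move=> Ac; rewrite /ann /= mulrCA; exact: idealMl.
Qed.

Lemma exists_max_ann A r : is_ideal A -> ~ A r ->
  exists2 z, max_ann A z & ann A r `<=` ann A z.
Proof.
move=> iA nAr; pose F : set (set R) := [set B | exists2 z, ~ A z & B = ann A z].
have Fid B : F B -> is_ideal B by case=> z _ ->; exact: ann_ideal.
have FAr : F (ann A r) by exists r.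
have [_ [[z nAz ->] rz zmax]] := noetherian_max noeth Fid FAr.
exists z => //; split=> // z' nAz' zz'; apply: zmax => //; by exists z'.
Qed.

(** A product of elements chosen outside the prime [P], one in each ideal. *)
Lemma avoid_prod P (T : eqType) (s : seq T) (f : T -> set R) :
  is_prime P -> (forall t, t \in s -> is_ideal (f t) /\ ~ f t `<=` P) ->
  exists2 b, ~ P b & forall t, t \in s -> f t b.
Proof.
move=> [iP P1 Pmul]; elim: s => [_|t s IH fs]; first by exists 1.
have [|b nPb fb] := IH; first by move=> u su; apply: fs; rewrite inE su orbT.
have [ift /existsNP[c /not_implyP[fc nPc]]] := fs t (mem_head _ _).
exists (c * b); first by case/Pmul.
move=> u; rewrite inE => /orP[/eqP ->|su]; first exact: idealMr.
by apply: idealMl; [case: (fs u); rewrite ?inE ?su ?orbT | exact: fb].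
Qed.

(** If the [z] in [s] span all elements with maximal annihilator modulo [A],
    the intersection of their annihilators lies in each maximal annihilator;
    the latter being prime, each is the annihilator of an element of [s]. *)
Lemma finite_max_ann A : is_ideal A -> exists2 s : seq R,
  forall z, z \in s -> max_ann A z &
  forall z, max_ann A z -> exists2 z', z' \in s & ann A z' = ann A z.
Proof.
move=> iA; pose F : set (set R) := [set B | exists2 s : seq R,
  forall z, z \in s -> max_ann A z & B = adjoins A s].
have Fid B : F B -> is_ideal B by case=> s _ ->; exact: adjoins_ideal.
have [|_ [[s smax ->] _ Amax]] := @noetherian_max R F noeth Fid A.
  by exists [::].
exists s => // z zmax; apply: contrapT => nz.
have sz : adjoins A s z.
  rewrite -(Amax (adjoins A (rcons s z))).
  - by apply: mem_adjoins => //; rewrite mem_rcons mem_head.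
  - exists (rcons s z) => // y; rewrite mem_rcons inE => /orP[/eqP -> //|].
    exact: smax.
  - apply: adjoins_mono => //; first exact: sub_adjoins.
    by move=> a sa; apply: mem_adjoins => //; rewrite mem_rcons inE sa orbT.
have [|b nb bs] := @avoid_prod (ann A z) _ s (ann A) (max_ann_prime iA zmax).
  move=> y sy; split; first exact: ann_ideal.
  move=> yz; apply: nz; exists y => //; apply/esym.
  by case: (smax y sy) => _; apply; case: zmax.
have iC : is_ideal [set y | A (b * y)].
  split=> [|x y|r y]; rewrite /= ?mulr0 ?mulrDr; first exact: ideal0.
    exact: idealD.
  by rewrite mulrCA => Ay; exact: idealMl.
apply: nb; apply: (adjoins_min iC) sz => [a Aa|y /bs //].
exact: idealMl.
Qed.

(** Prime avoidance for a coset of [B]; the primes are treated one at a time,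
    the element being corrected by a multiple of some [b] lying in the primes
    already avoided but not in the current one. *)
Lemma coset_avoid A B a s : is_ideal A -> is_ideal B ->
  (forall z, z \in s -> max_ann A z) ->
  (forall z, z \in s -> ~ (ann A z a /\ B `<=` ann A z)) ->
  exists2 u, B (u - a) & forall z, z \in s -> ~ ann A z u.
Proof.
move=> iA iB; elim: s => [_ _|z s IH smax sB].
  by exists a => //; rewrite subrr; exact: ideal0.
have s_zs y : y \in s -> y \in z :: s by rewrite inE orbC => ->.
have [||u Bua us] := IH; [by move=> y /s_zs/smax | by move=> y /s_zs/sB |].
case: (pselect (ann A z u)) => [zu|nzu]; last first.
  by exists u => // y; rewrite inE => /orP[/eqP -> //|]; exact: us.
have iz := ann_ideal z iA; have zmax := smax z (mem_head _ _).
have [|b nzb bs] := @avoid_prod (ann A z) _ s (ann A) (max_ann_prime iA zmax).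
  move=> y sy; split; first exact: ann_ideal.
  move=> yz; apply: (us y sy); suff <- : ann A z = ann A y by [].
  by case: (smax y (s_zs y sy)) => _; apply => //; case: zmax.
have [c Bc nzc] : exists2 c, B c & ~ ann A z c.
  apply: contrapT => nc; apply: (sB z (mem_head _ _)).
  have Bz : B `<=` ann A z.
    by move=> c Bc; apply: contrapT => nzc; apply: nc; exists c.
  by split=> //; rewrite -(subKr u a); apply: idealB => //; apply: Bz.
exists (u + c * b).
  by rewrite addrAC; apply: idealD => //; exact: idealMr.
move=> y; rewrite inE => /orP[/eqP ->|sy].
  move/(ideal_addr iz zu); have [_ _ zmul] := max_ann_prime iA zmax.
  by case/zmul.
move=> yu; apply: (us y sy); apply: (ideal_addl (ann_ideal y iA) _ yu).
by apply: idealMl; [exact: ann_ideal | exact: bs].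
Qed.

Lemma coset_nzd A B a : is_ideal A -> is_ideal B ->
  (exists2 u, B (u - a) & nzd A u) \/
  exists z, [/\ ~ A z, A (a * z) & forall b, B b -> A (b * z)].
Proof.
move=> iA iB; have [s smax sP] := finite_max_ann iA.
case: (pselect (exists2 z, z \in s & ann A z a /\ B `<=` ann A z)).
  by case=> z /smax[nAz _] [Aaz Bz]; right; exists z.
move=> ns; left; have [z sz zaB|u Bua us] := coset_avoid iA iB smax (a := a).
  by apply: ns; exists z.
exists u => // r Aur; apply: contrapT => nAr.
have [z /sP[z' sz' <-] rz] := exists_max_ann iA nAr.
exact: us sz' (rz _ Aur).
Qed.

(** Depth is realized by every system of parameters.  Given a regular sequence
    [y] of the same length as [s], the last term of [y] may be exchanged for
    some [u] congruent to the first term of [s] modulo the others: were all such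
    [u] zero divisors modulo the previous terms of [y], a single nonzero class
    would be killed by [s], hence by a power of the last term of [y].  Moving
    [u] to the front, one concludes by induction modulo [u]. *)
Theorem parameters_regular A s y : is_ideal A ->
  (forall a, a \in s -> m a) -> (forall a, a \in y -> m a) ->
  size s = size y -> regular_mod A y ->
  (forall a, m a -> exists k, adjoins A s (a ^+ k)) ->
  regular_mod A s.
Proof.
move=> iA; elim: s y A iA => // s1 s IH y A iA ms my.
case/lastP: y my => // y yn my; rewrite size_rcons => -[size_sy] ry srad.
have im := maximal_ideal Rlocal.
have ms' a : a \in s -> m a by move=> sa; apply: ms; rewrite inE sa orbT.
have my' a : a \in y -> m a.
  by move=> ya; apply: my; rewrite mem_rcons inE ya orbT.
have myn : m yn by apply: my; rewrite mem_rcons mem_head.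
move: ry; rewrite -cats1 => /regular_mod_cat[ry [nyn _]].
have iAy := adjoins_ideal y iA; have i0s := adjoins_ideal s (@is_ideal0 R).
have s0m : adjoins [set 0] s `<=` m.
  by apply: adjoins_min => // _ ->; exact: ideal0.
have [[u su nu]|[z [nz s1z sz]]] := coset_nzd s1 iAy i0s; last first.
  have [k yk] := srad yn myn; case: nz; move: yk.
  have : adjoins A (s1 :: s) `<=` ann (adjoins A y) z.
    apply: adjoins_min; first exact: ann_ideal.
      by move=> a Aa; apply: idealMr => //; exact: sub_adjoins.
    move=> a; rewrite inE => /orP[/eqP -> //|sa]; apply: sz.
    by apply: mem_adjoins => //; exact: is_ideal0.
  move=> sub /sub; elim: k => [|k IHk]; first by rewrite /ann /= expr0 mul1r.
  by rewrite /ann /= exprS -mulrA => /nyn.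
have mu : m u.
  rewrite -(subrK s1 u); apply: idealD => //; first exact: s0m.
  by apply: ms; exact: mem_head.
have su_A B : is_ideal B -> adjoins B s (u - s1).
  move=> iB; apply: adjoins_min su => [|_ ->|a]; first exact: adjoins_ideal.
    by apply: ideal0; exact: adjoins_ideal.
  exact: mem_adjoins.
have rs : regular_mod A (u :: s).
  have ruy : regular_mod A (u :: y).
    by apply: regular_mod_cons => //; rewrite -cats1; apply/regular_mod_cat.
  split; first by case: ruy.
  have iAu := adjoin_ideal u iA.
  apply: (IH y) => // [|a ma]; first by case: ruy.
  have [k sk] := srad a ma; exists k; move: sk.
  apply: adjoins_mono => // [b Ab|b].
    by apply: sub_adjoins; exact: sub_adjoin.
  rewrite inE => /orP[/eqP ->|sb]; last exact: mem_adjoins.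
  rewrite -(subKr u s1); apply: idealB; [exact: adjoins_ideal | | exact: su_A].
  by apply: sub_adjoins; exact: mem_adjoin.
apply: regular_mod_cons => //; move: (regular_mod_rcons iA mu rs).
rewrite -!cats1 => /regular_mod_cat[rs' [nus _]].
apply/regular_mod_cat; split=> //; split=> //.
by apply: nzd_congr nus; [exact: adjoins_ideal | exact: su_A].
Qed.

End RegularSequences.

(** * Parameters in a Cohen-Macaulay local ring *)

Lemma krull_dim_inj (R : comNzRingType) a b :
  krull_dim R a -> krull_dim R b -> a = b.
Proof.
move=> [[c cP] amax] [[c' c'P] bmax]; apply/eqP; rewrite eqn_leq.
by rewrite (bmax _ _ cP) (amax _ _ c'P).
Qed.

Section PowersOfParameters.
Variables (R : comNzRingType) (m : set R) (p : nat).
Hypotheses (noeth : noetherian R) (Rlocal : is_local m).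
Hypothesis Rchar : p \in [pchar R].

Lemma ideal_gen_expr_pchar (G B : set R) e a : is_ideal B ->
  (forall v, G v -> B (v ^+ (p ^ e))) -> ideal_gen G a -> B (a ^+ (p ^ e)).
Proof.
move=> iB GB; have q_gt0 := expr_pchar_gt0 Rchar e.
have iC : is_ideal [set a | B (a ^+ (p ^ e))].
  split=> [|b c Bb Bc|r b Bb] /=.
  - by rewrite expr0n -[_ == _]negbK -lt0n q_gt0; exact: ideal0.
  - by rewrite exprD_pchar //; exact: idealD.
  - by rewrite exprMn; exact: idealMl.
exact: (ideal_gen_min iC GB).
Qed.

(** The depth condition provides a regular sequence whose length is the dimension,
    hence the number of parameters. *)
Lemma cohen_macaulay_regular s : cohen_macaulay_local m ->
  krull_dim R (size s) -> (forall a, a \in s -> m a) ->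
  (forall a, m a -> exists k, adjoins [set 0] s (a ^+ k)) ->
  regular_mod [set 0] s.
Proof.
move=> [n [dim_n [[y [size_y ym [yreg _]]] _]]] dim_s sm srad.
apply: (parameters_regular noeth Rlocal Rchar (is_ideal0 R) sm ym) srad.
  by rewrite size_y; exact: krull_dim_inj dim_s dim_n.
apply: regular_modP => i lti r; rewrite -ideal_gen_adjoins mulrC.
exact: yreg.
Qed.

(** Raising the parameters to positive powers changes neither their number nor
    the radical of the ideal they generate. *)
Lemma parameter_powers_nzd d (x : d.-tuple R) (n : 'I_d -> nat) i :
  cohen_macaulay_local m -> part_of_system_of_parameters m x ->
  (forall j, (0 < n j)%N) ->
  nzd (span (fun j => j != i) (fun j => tnth x j ^+ n j)) (tnth x i ^+ n i).
Proof.
move=> RCM [s [dim_xs xsm xsrad]] n_gt0; have im := maximal_ideal Rlocal.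
pose g j := tnth x j ^+ n j; pose t := [seq g j | j <- rem i (enum 'I_d)].
have mem_t v : (v \in t) <-> exists2 j, j != i & v = g j.
  split=> [/mapP[j]|[j ji ->]].
    by rewrite mem_rem_uniq ?enum_uniq // inE => /andP[ji _] ->; exists j.
  by apply: map_f; rewrite mem_rem_uniq ?enum_uniq // inE ji mem_enum.
pose L := t ++ g i :: s; pose Q := adjoins [set 0] L.
have iQ : is_ideal Q by apply: adjoins_ideal; exact: is_ideal0.
have memQ v : v \in L -> Q v by apply: mem_adjoins; exact: is_ideal0.
have gL j : g j \in L.
  rewrite mem_cat inE; have [->|ji] := eqVneq j i; first by rewrite eqxx orbT.
  by apply/orP; left; apply/mem_t; exists j.
have sL v : v \in s -> v \in L by move=> sv; rewrite mem_cat inE sv !orbT.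
have Lm v : v \in L -> m v.
  rewrite mem_cat inE => /or3P[/mem_t[j _ ->]|/eqP ->|sv]; last first.
  - by apply: xsm; rewrite /= mem_cat sv orbT.
  - by apply: idealX => //; apply: xsm; rewrite /= mem_cat mem_tnth.
  - by apply: idealX => //; apply: xsm; rewrite /= mem_cat mem_tnth.
have : regular_mod [set 0] L.
  apply: cohen_macaulay_regular => // [|a /xsrad[k xsk]].
    suff -> : size L = size (x ++ s) by [].
    rewrite !size_cat size_map size_rem ?mem_enum //= size_enum_ord size_tuple.
    by rewrite addnS -addSn prednK // (leq_ltn_trans _ (ltn_ord i)).
  pose e := (\max_(j < d) n j)%N; exists (k * p ^ e)%N; rewrite exprM.
  apply: ideal_gen_expr_pchar xsk => // v /=; rewrite mem_cat.
  case/orP=> [/tnthP[j ->]|sv].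
    have le_nj : (n j <= p ^ e)%N.
      by apply: (expr_pchar_leq Rchar); exact: (leq_bigmax j).
    by rewrite -(subnK le_nj) exprD; exact: (idealMl iQ _ (memQ _ (gL j))).
  exact: (idealX iQ (memQ _ (sL _ sv)) (expr_pchar_gt0 Rchar e)).
case/regular_mod_cat => _ [nzd_gi _].
suff <- : ideal_gen [set` t] = span (fun j => j != i) g.
  by rewrite ideal_gen_adjoins.
by apply: ideal_gen_span => [j ji|v /= /mem_t //]; apply/mem_t; exists j.
Qed.

End PowersOfParameters.

(** * Tight closure in a domain *)

(** The localization of a local ring at its maximal ideal is the ring itself. *)
Lemma normal_local_domain (R : comNzRingType) (m : set R) :
  noetherian R -> is_local m -> normal_ring R ->
  forall a b : R, a * b = 0 -> a = 0 \/ b = 0.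
Proof.
move=> noeth Rlocal Rnormal.
have m_prime : is_prime m.
  split; [exact: maximal_ideal | exact: maximal_not1 | move=> a b mab].
  case: (pselect (m a)) => [|/(local_unit noeth Rlocal)[u ua]]; first by left.
  right.
  by rewrite -(mul1r b) -ua -mulrA; apply: idealMl => //; exact: maximal_ideal.
have [|K [f [[funit _ _] _]]] := Rnormal m R idfun m_prime; first split=> /=.
- by move=> s /(local_unit noeth Rlocal).
- by move=> y; exists y, 1; split; [exact: maximal_not1 | rewrite mulr1].
- by move=> a ->; exists 1; split; [exact: maximal_not1 | rewrite mulr0].
have f_inj a : f a = 0 -> a = 0.
  move=> fa; apply: contrapT => /funit[u]; rewrite fa mulr0.
  by move/esym/eqP; rewrite oner_eq0.
move=> a b /(congr1 f); rewrite rmorphM rmorph0 => /eqP.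
by rewrite mulf_eq0 => /orP[] /eqP /f_inj; [left | right].
Qed.

Section TightClosure.
Variables (R : comNzRingType) (p : nat).
Hypotheses (noeth : noetherian R) (Rchar : p \in [pchar R]).
Hypothesis Rdomain : forall a b : R, a * b = 0 -> a = 0 \/ b = 0.
Implicit Types (A L : set R).

Lemma off_minimal_primesP (c : R) : off_minimal_primes c <-> c <> 0.
Proof.
have prime0 : is_prime ([set 0] : set R).
  split=> [||a b /Rdomain //]; first exact: is_ideal0.
  by move/eqP; rewrite oner_eq0.
split=> [c0 c_eq0|c0 P [[iP _ _] Pmin] Pc].
  apply: (c0 [set 0] _ c_eq0); split=> // Q [iQ _ _] Q0.
  by apply/seteqP; split=> // _ ->; exact: ideal0.
suff P0 : P = [set 0] by rewrite P0 in Pc.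
by apply/esym/Pmin => // _ ->; exact: ideal0.
Qed.

Lemma tight_closureP A y : tight_closure p A y <->
  exists2 c, c <> 0 & exists N, forall e, (N <= e)%N ->
    frobenius_power A (p ^ e) (c * y ^+ (p ^ e)).
Proof. by split=> -[c /off_minimal_primesP c0 cN]; exists c. Qed.

Lemma frobenius_power_mono A L n : A `<=` L ->
  frobenius_power A n `<=` frobenius_power L n.
Proof.
move=> AL; apply: ideal_gen_min => [|_ [a Aa <-]].
  exact: frobenius_power_ideal.
by apply: mem_frobenius_power; exact: AL.
Qed.

Lemma tight_closure_mono A L :
  A `<=` L -> tight_closure p A `<=` tight_closure p L.
Proof.
move=> AL y [c c0 [N cN]]; exists c => //; exists N => e /cN.
exact: frobenius_power_mono.
Qed.

Lemma sub_tight_closure A : A `<=` tight_closure p A.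
Proof.
move=> a Aa; apply/tight_closureP; exists 1; first by apply/eqP; rewrite oner_eq0.
by exists 0%N => e _; rewrite mul1r; exact: mem_frobenius_power.
Qed.

(** The Frobenius powers compose, so the tail of a sequence of memberships for
    [b] is one for [b ^+ (p ^ e)]. *)
Lemma tight_closure_frobenius A b e : tight_closure p A b ->
  tight_closure p (frobenius_power A (p ^ e)) (b ^+ (p ^ e)).
Proof.
move=> [c c0 [N cN]]; exists c => //; exists N => e' le_e'.
rewrite -exprM -expnD; have := cN (e + e')%N (leq_trans le_e' (leq_addl _ _)).
apply: ideal_gen_min => [|_ [a Aa <-]]; first exact: frobenius_power_ideal.
by rewrite expnD exprM; do 2 apply: mem_frobenius_power.
Qed.

(** The product of the multipliers is nonzero because the ring is a domain. *)
Lemma common_multiplier (T : finType) (g : T -> R) L :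
  (forall i, tight_closure p L (g i)) -> exists2 c, c <> 0 &
    exists N, forall e, (N <= e)%N ->
      forall i, frobenius_power L (p ^ e) (c * g i ^+ (p ^ e)).
Proof.
move=> gL; have /choice[c cP] i : exists c, c <> 0 /\ exists N,
    forall e, (N <= e)%N -> frobenius_power L (p ^ e) (c * g i ^+ (p ^ e)).
  by have [c c0 cN] := iffLR (tight_closureP L (g i)) (gL i); exists c.
have /choice[N NP] i := (cP i).2.
exists (\prod_i c i).
  apply: (big_ind (fun a : R => a <> 0)) => [|a b a0 b0 /Rdomain[]//|i _].
    by apply/eqP; rewrite oner_eq0.
  by case: (cP i).
exists (\max_i N i)%N => e le_e i; rewrite (bigD1 i) //= mulrAC.
apply: (idealMr (frobenius_power_ideal L (p ^ e))).
by apply: NP; apply: leq_trans le_e; exact: (leq_bigmax i).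
Qed.

Lemma tight_closure_span_trans (T : finType) (g : T -> R) L :
  (forall i, tight_closure p L (g i)) ->
  tight_closure p (span xpredT g) `<=` tight_closure p L.
Proof.
move=> gL y /tight_closureP[c0 c0_neq0 [N0 c0P]].
have [c c_neq0 [N cP]] := common_multiplier gL.
apply/tight_closureP; exists (c * c0) => [/Rdomain[]//|].
exists (maxn N N0) => e; rewrite geq_max => /andP[le_e le0_e].
have := c0P e le0_e; rewrite frobenius_power_span // => -[r yr].
rewrite -mulrA yr mulr_sumr; apply: ideal_sum => [|i _].
  exact: frobenius_power_ideal.
rewrite mulrCA; apply: (idealMl (frobenius_power_ideal L (p ^ e))).
exact: cP.
Qed.

Lemma tight_closure_trans A L : is_ideal A -> A `<=` tight_closure p L ->
  tight_closure p A `<=` tight_closure p L.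
Proof.
move=> /(noetherian_span noeth)[n [g ->]] gL.
by apply: tight_closure_span_trans => i; apply: gL; exact: mem_span.
Qed.

(** Frobenius powers carry elements of the tight closure of [A] to elements of
    the tight closures of the Frobenius powers of [A], to which the test element
    applies as well; so it is a multiplier for every exponent. *)
Lemma test_multiplier A z b e : is_ideal A -> test_ideal p z ->
  tight_closure p A b -> frobenius_power A (p ^ e) (z * b ^+ (p ^ e)).
Proof.
move=> iA ztest /(tight_closure_frobenius e).
exact: ztest (frobenius_power_ideal _ _) _.
Qed.

End TightClosure.

Arguments frobenius_power_mono {R A L n} _ {t} _.
Arguments test_multiplier {R p A z b} e _ _ _.

(** * Matrices over a local ring *)

(** Over the residue field, a matrix has a left inverse or a nonzero kernel; a
    lift of a left inverse is one up to an invertible determinant. *)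
Lemma local_left_inverse (R : comNzRingType) (m : set R) (k : fieldType)
    (res : {rmorphism R -> k}) n d (A : 'M[R]_(n, d)) :
    noetherian R -> is_local m -> is_residue_field m res ->
  (exists C : 'M[R]_(d, n), C *m A = 1%:M) \/
  exists2 v : 'I_d -> R, exists i, ~ m (v i) &
    forall j, m (\sum_i A j i * v i).
Proof.
move=> noeth Rlocal [res0 ressurj].
have res_lift y : exists a, res a = y.
  have [a [b [/(local_unit noeth Rlocal)[u ub] ->]]] := ressurj y.
  exists (a * u); rewrite rmorphM; congr (_ * _).
  have rub : res u * res b = 1 by rewrite -rmorphM ub rmorph1.
  have rb0 : res b != 0.
    by apply: contra_eq_neq rub => ->; rewrite mulr0 eq_sym oner_eq0.
  by rewrite -(mul1r (res b)^-1) -rub mulfK.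
have /choice[lift liftK] := res_lift.
have [/row_fullP[B BA1]|] := boolP (row_full (map_mx res A)).
  left; pose D := map_mx lift B *m A.
  have resD : map_mx res D = 1%:M.
    rewrite map_mxM -BA1; congr (_ *m _).
    by apply/matrixP=> i j; rewrite !mxE liftK.
  have [|u uD] := local_unit noeth Rlocal (r := \det D).
    by move/res0/eqP; rewrite -det_map_mx resD det1 oner_eq0.
  exists (u *: (\adj D *m map_mx lift B)).
  rewrite -scalemxAl -mulmxA mul_adj_mx scale_scalar_mx.
  by rewrite uD.
rewrite /row_full -mxrank_tr -[_ == _]/(row_free _) -kermx_eq0.
case/rowV0Pn=> v /sub_kermxP vA v0; right.
exists (fun i => lift (v 0 i)).
  apply: contrapT => /forallNP vm; move/eqP: v0; apply; apply/rowP => i.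
  by have /contrapT/res0 := vm i; rewrite liftK mxE.
move=> j; apply/res0; rewrite rmorph_sum /=.
transitivity ((v *m (map_mx res A)^T) 0 j); last by rewrite vA mxE.
by rewrite mxE; apply: eq_bigr => i _; rewrite rmorphM liftK !mxE mulrC.
Qed.

(** * Powers of parameters and colon ideals *)

Lemma eq_span (R : comNzRingType) (T : finType) (P : pred T) (g g' : T -> R) :
  (forall i, P i -> g i = g' i) -> span P g = span P g'.
Proof.
move=> gg'; apply/seteqP; split=> y [r ->]; exists r;
  by apply: eq_bigr => i /gg' ->.
Qed.

Section StarCore.
(* The first two parameters are those with indices [i0] and [i1], and [s.+2] is
   the exponent with which they occur among the generators of [J]. *)
Variables (R : comNzRingType) (m : set R) (p d : nat) (x : 'I_d -> R).
Variables (i0 i1 : 'I_d) (s : nat).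
Hypotheses (noeth : noetherian R) (Rlocal : is_local m).
Hypothesis Rchar : p \in [pchar R].
Hypothesis Rdomain : forall a b : R, a * b = 0 -> a = 0 \/ b = 0.
Hypothesis i10 : i1 != i0.
Hypothesis xm : forall i, m (x i).
Hypothesis x_nzd : forall n, (forall j, (0 < n j)%N) -> forall i,
  nzd (span (fun j => j != i) (fun j => x j ^+ n j)) (x i ^+ n i).
Hypotheses (test0 : test_ideal p (x i0)) (test1 : test_ideal p (x i1)).

Let im : is_ideal m := maximal_ideal Rlocal.

Definition powers (n : 'I_d -> nat) : set R :=
  span xpredT (fun j => x j ^+ n j).

Lemma powers_ideal n : is_ideal (powers n). Proof. exact: span_ideal. Qed.

(** Cancelling a power of one parameter: it is not a zero divisor modulo powers of
    the others. *)
Lemma colon_power i a (n n' : 'I_d -> nat) r : (0 < a)%N ->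
  (forall j, (0 < n' j)%N) -> n i = (a + n' i)%N ->
  (forall j, j != i -> n j = n' j) ->
  powers n (x i ^+ a * r) -> powers n' r.
Proof.
move=> a_gt0 n'_gt0 ni nn'; pose n2 j := if j == i then a else n' j.
have n2_gt0 j : (0 < n2 j)%N by rewrite /n2; case: eqP.
move/(@span_addD _ _ (fun j => x j ^+ n j) _ i _ isT) => -[v].
have eqn : span (fun j => j != i) (fun j => x j ^+ n j)
         = span (fun j => j != i) (fun j => x j ^+ n2 j).
  by apply: eq_span => j ji; rewrite nn' // /n2 (negbTE ji).
have eqn' : span (fun j => j != i) (fun j => x j ^+ n' j)
          = span (fun j => j != i) (fun j => x j ^+ n2 j).
  by apply: eq_span => j ji; rewrite /n2 (negbTE ji).
rewrite /= eqn ni exprD => sr.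
apply/(@span_addD _ _ (fun j => x j ^+ n' j) _ i _ isT); exists v.
rewrite /= eqn'; apply: (@x_nzd n2 n2_gt0 i).
rewrite [n2 i]/n2 eqxx.
by move: sr; rewrite mulrCA -mulrBr.
Qed.

Let expo c0 c1 q (j : 'I_d) : nat :=
  if j == i0 then c0 else if j == i1 then c1 else q.

Let expo_gt0 c0 c1 q j :
  (0 < c0)%N -> (0 < c1)%N -> (0 < q)%N -> (0 < expo c0 c1 q j)%N.
Proof. by rewrite /expo; case: (j == i0); case: (j == i1). Qed.

Let expo0 c0 c1 q : expo c0 c1 q i0 = c0. Proof. by rewrite /expo eqxx. Qed.

Let expo1 c0 c1 q : expo c0 c1 q i1 = c1.
Proof. by rewrite /expo (negbTE i10) eqxx. Qed.

Lemma colon_expo0 a c0 c1 q r : (0 < a)%N -> (0 < c0)%N -> (0 < c1)%N ->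
  (0 < q)%N -> powers (expo (a + c0) c1 q) (x i0 ^+ a * r) ->
  powers (expo c0 c1 q) r.
Proof.
move=> a_gt0 c0_gt0 c1_gt0 q_gt0; apply: colon_power => //.
- by move=> j; exact: expo_gt0.
- by rewrite !expo0.
- by move=> j ji0; rewrite /expo (negbTE ji0).
Qed.

Lemma colon_expo1 a c0 c1 q r : (0 < a)%N -> (0 < c0)%N -> (0 < c1)%N ->
  (0 < q)%N -> powers (expo c0 (a + c1) q) (x i1 ^+ a * r) ->
  powers (expo c0 c1 q) r.
Proof.
move=> a_gt0 c0_gt0 c1_gt0 q_gt0; apply: colon_power => //.
- by move=> j; exact: expo_gt0.
- by rewrite !expo1.
- by move=> j ji1; rewrite /expo (negbTE ji1).
Qed.

Let f (j : 'I_d) : R :=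
  if (j == i0) || (j == i1) then x j ^+ s.+2 else x j.
Let w : R := (x i0 * x i1) ^+ s.+1.
Let J : set R := span xpredT f.
Let K : set R := span xpredT x.

Lemma J_ideal : is_ideal J. Proof. exact: span_ideal. Qed.

Lemma K_ideal : is_ideal K. Proof. exact: span_ideal. Qed.

Let fX q j : f j ^+ q = x j ^+ expo (s.+2 * q) (s.+2 * q) q j.
Proof.
by rewrite /f /expo; case: (j == i0); case: (j == i1); rewrite //= -exprM.
Qed.

Let span_fX q : span xpredT (fun j => f j ^+ q)
  = powers (expo (s.+2 * q) (s.+2 * q) q).
Proof. by apply: eq_span => j _; exact: fX. Qed.

Let span_xX q : span xpredT (fun j => x j ^+ q) = powers (expo q q q).
Proof. by apply: eq_span => j _; rewrite /expo !if_same. Qed.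

Lemma mem_f j : J (f j). Proof. exact: mem_span. Qed.

Lemma x_in_K j : K (x j). Proof. exact: mem_span. Qed.

Lemma K_sub_m : K `<=` m. Proof. exact: span_sub. Qed.

Lemma J_sub_K : J `<=` K.
Proof.
apply: span_sub => [|j _]; first exact: K_ideal.
rewrite /f; case: ifP => _; last exact: x_in_K.
by apply: idealX => //; [exact: K_ideal | exact: x_in_K].
Qed.

Lemma colon_wX q r : (0 < q)%N ->
  span xpredT (fun j => f j ^+ q) (w ^+ q * r) ->
  span xpredT (fun j => x j ^+ q) r.
Proof.
move=> q_gt0; rewrite span_fX span_xX /w -exprM exprMn -mulrA.
rewrite mulSn addnC => /colon_expo0 J0.
apply: (@colon_expo1 (s.+1 * q)); rewrite ?muln_gt0 //.
by apply: J0; rewrite ?muln_gt0 ?addn_gt0 ?q_gt0 ?orbT.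
Qed.

Lemma colon_w r : J (w * r) -> K r.
Proof. exact: (@colon_wX 1). Qed.

Lemma colon_w_frobenius e r :
  frobenius_power J (p ^ e) (w ^+ (p ^ e) * r) -> frobenius_power K (p ^ e) r.
Proof.
rewrite /J /K !frobenius_power_span //.
exact: colon_wX (expr_pchar_gt0 Rchar e).
Qed.

(** The entry [r i] is killed by [f i ^+ q] modulo the other [f j ^+ q], which is
    not a zero divisor there. *)
Lemma syzygy q (r : 'I_d -> R) i : (0 < q)%N -> \sum_j r j * f j ^+ q = 0 ->
  span xpredT (fun j => f j ^+ q) (r i).
Proof.
move=> q_gt0 rf0; pose n := expo (s.+2 * q) (s.+2 * q) q.
have n_gt0 j : (0 < n j)%N by apply: expo_gt0; rewrite ?muln_gt0.
apply: (@span_sub _ _ _ (fun j => j != i)); first exact: span_ideal.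
  by move=> j _; exact: mem_span.
have -> : span (fun j => j != i) (fun j => f j ^+ q)
        = span (fun j => j != i) (fun j => x j ^+ n j).
  by apply: eq_span => j _; exact: fX.
apply: (@x_nzd n n_gt0 i); rewrite -fX mulrC; move/eqP: rf0.
rewrite (bigD1 i) //= addr_eq0 => /eqP ->.
apply: idealN; first exact: span_ideal.
by exists r; apply: eq_bigr => j _; rewrite fX.
Qed.

(** The colon ideal of [J] by the first two parameters: [x i0 * r] in [J] gives
    [r = c * x i0 ^+ s.+1] modulo [J], and then [x i1 * r] in [J] forces [c]
    into the ideal generated by [x i1 ^+ s.+1] and the other parameters. *)
Lemma colon_first_two r :
  J (x i0 * r) -> J (x i1 * r) -> exists c, J (r - c * w).
Proof.
have JE : J = powers (expo s.+2 s.+2 1) by have := span_fX 1; rewrite muln1.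
move=> Jr0 Jr1; have := Jr0.
rewrite JE => /(@colon_expo0 1 s.+1 s.+2 1 r isT isT isT isT).
move=> /(@span_addD _ _ (fun j => x j ^+ _ j) _ i0 _ isT)[c].
rewrite expo0 /= => rc.
have {}rc : J (r - c * x i0 ^+ s.+1).
  rewrite JE; apply: span_sub rc => [|j ji0]; first exact: powers_ideal.
  suff -> : expo s.+1 s.+2 1 j = expo s.+2 s.+2 1 j by exact: mem_span.
  by rewrite /expo (negbTE ji0).
have Jc : powers (expo (s.+1 + 1) s.+2 1) (x i0 ^+ s.+1 * (x i1 * c)).
  rewrite addn1 -JE; have := idealB J_ideal Jr1 (idealMl J_ideal (x i1) rc).
  by congr (J _); ring.
have {}Jc := @colon_expo0 s.+1 1 s.+2 1 (x i1 * c) isT isT isT isT Jc.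
have := @colon_expo1 1 1 s.+1 1 c isT isT isT isT Jc.
move=> /(@span_addD _ _ (fun j => x j ^+ _ j) _ i1 _ isT)[b].
rewrite expo1 /= => cb; exists b; rewrite -JE.
rewrite -[r](subrK (c * x i0 ^+ s.+1)) -addrA.
apply: idealD => //; first exact: J_ideal.
suff : J ((c - b * x i1 ^+ s.+1) * x i0 ^+ s.+1).
  by rewrite mulrBl /w exprMn [x i0 ^+ _ * _]mulrC mulrA.
have iC : is_ideal [set y | J (y * x i0 ^+ s.+1)].
  have iJ := J_ideal; split=> [|y z|a y] /=; rewrite ?mul0r ?mulrDl.
  - exact: ideal0.
  - exact: idealD.
  - by rewrite -mulrA => Jy; exact: idealMl.
apply: (span_sub iC) cb => j ji1; rewrite /= /expo (negbTE ji1).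
case: eqP => [->|/eqP ji0].
  by rewrite -exprD; have := mem_f i0; rewrite /f eqxx.
apply: idealMr; first exact: J_ideal.
by have := mem_f j; rewrite /f (negbTE ji0) (negbTE ji1).
Qed.

(** * Tight closures of parameter ideals *)

(** The elements [z j] and [h j] factor the coefficient of [f j] in
    [w * x j = z j * h j * f j], with [z j] one of the two test elements. The
    factor [z j] puts this coefficient in [(J : I)]; its presence is what the
    exponent [s.+2 >= 2] in [f] provides. *)
Let z (j : 'I_d) : R := if j == i0 then x i1 else x i0.
Let h (j : 'I_d) : R :=
  if j == i0 then x i1 ^+ s else if j == i1 then x i0 ^+ s
  else x i1 * (x i0 * x i1) ^+ s.

Let wx j : w * x j = z j * h j * f j.
Proof.
rewrite /w /z /h /f exprMn !exprS; case: eqP => [->|_] /=; first by ring.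
by case: eqP => [->|_] /=; rewrite ?exprMn; ring.
Qed.

Let wxX q j : w ^+ q * x j ^+ q = z j ^+ q * h j ^+ q * f j ^+ q.
Proof. by rewrite -!exprMn wx. Qed.

Let z_test j : test_ideal p (z j). Proof. by rewrite /z; case: ifP. Qed.

Let zm j : m (z j). Proof. by rewrite /z; case: ifP. Qed.

Let zK j : K (z j). Proof. by rewrite /z; case: ifP => _; exact: mem_span. Qed.

Let tc := @tight_closure R p.

Let frob (A : set R) e : set R := frobenius_power A (p ^ e).

Let frob_ideal A e : is_ideal (frob A e).
Proof. exact: frobenius_power_ideal. Qed.

Lemma frobenius_m_trivial c N : (forall e, (N <= e)%N -> frob m e c) -> c = 0.
Proof.
move=> mc; apply: (krull_intersection noeth Rlocal Rchar (is_ideal0 R)) => e0.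
exists (maxn e0 N); first exact: leq_maxl.
by exists c; [apply: mc; exact: leq_maxr | exact: subrr].
Qed.

Lemma x_neq0 j : x j <> 0.
Proof.
move=> xj0; apply: (maximal_not1 Rlocal).
have : span (fun i => i != j) (fun i => x i ^+ 1) 1.
  apply: (@x_nzd (fun=> 1%N)) => //; rewrite mulr1 [x j ^+ 1]xj0.
  by apply: ideal0; exact: span_ideal.
by apply: span_sub => // i _; exact: xm.
Qed.

Lemma z_neq0 j : z j <> 0.
Proof. by rewrite /z; case: ifP => _; exact: x_neq0. Qed.

Lemma tc_colon_w b : tc J (w * b) -> tc K b.
Proof.
case/(tight_closureP p Rdomain)=> c c0 [N cN].
apply/(tight_closureP p Rdomain); exists c => //.
exists N => e /cN; rewrite exprMn mulrCA.
exact: colon_w_frobenius.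
Qed.

(** A unit in [K^*] would put its multiplier in all Frobenius powers of [m]. *)
Lemma tc_K_sub_m : tc K `<=` m.
Proof.
move=> b /(tight_closureP p Rdomain)[c c0 [N cN]]; apply: contrapT.
move=> /(local_unit noeth Rlocal)[u ub]; apply: c0.
apply: (@frobenius_m_trivial _ N) => e /cN Kcb.
have -> : c = u ^+ (p ^ e) * (c * b ^+ (p ^ e)).
  by rewrite mulrCA -exprMn ub expr1n mulr1.
apply: (idealMl (frob_ideal m e)).
exact: (frobenius_power_mono K_sub_m Kcb).
Qed.

(** For [b] in [K^*], the element [w * b] is a special element of [J^*]: up to a
    fixed multiplier its [q]-th power is a combination of the [f j ^+ q] with
    coefficients in the Frobenius power of [m], and the coefficient at [j] is
    moreover divisible by [z j ^+ q]. *)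
Lemma special_combination i b e : tc K b -> exists r : 'I_d -> R,
  z i * (w * b) ^+ (p ^ e)
    = \sum_j r j * (z j ^+ (p ^ e) * h j ^+ (p ^ e)) * f j ^+ (p ^ e).
Proof.
move=> Kb; have := test_multiplier e K_ideal (z_test i) Kb.
rewrite /K frobenius_power_span // => -[r rE]; exists r.
rewrite exprMn mulrCA rE mulr_sumr; apply: eq_bigr => j _.
by rewrite [w ^+ _ * _]mulrCA wxX; ring.
Qed.

(** * Ideals between [J] and [J^*] *)

Variable I : set R.
Hypotheses (iI : is_ideal I) (JI : J `<=` I) (Itc : I `<=` tc J).

Let C := colon J I.

Lemma test_colon j : C (z j).
Proof.
move=> a Ia; have := z_test j J_ideal; apply; exact: Itc.
Qed.

(** The test elements [x i0] and [x i1] multiply [I] into [J]. *)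
Lemma decompose_I y : I y -> exists2 b, I (w * b) & J (y - w * b).
Proof.
move=> Iy; have [||c Jc] := @colon_first_two y.
- by have := test_colon i1 Iy; rewrite /z (negbTE i10).
- by have := test_colon i0 Iy; rewrite /z eqxx.
exists c; last by rewrite mulrC.
by rewrite mulrC -[_ * w](subKr y); apply: idealB => //; exact: JI.
Qed.

Lemma Iw_tc b : I (w * b) -> tc K b.
Proof. by move=> Iwb; apply: tc_colon_w; exact: Itc. Qed.

Lemma wK_sub_JC a : K a -> ideal_mul J C (w * a).
Proof.
have iJC := ideal_gen_ideal [set a * b | a in J & b in C].
case=> r ->; rewrite mulr_sumr; apply: ideal_sum => // j _.
rewrite mulrCA wx; apply: (idealMl iJC); rewrite mulrAC mulrC.
apply: (idealMl iJC); rewrite mulrC; apply: mem_ideal_gen.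
by exists (f j); [exact: mem_f | exists (z j); [exact: test_colon | ]].
Qed.

Lemma wK_sub_J a : K a -> J (w * a).
Proof.
move/wK_sub_JC; apply: ideal_gen_min => [|_ [b Jb [c Cc <-]]].
  exact: J_ideal.
by apply: idealMr => //; exact: J_ideal.
Qed.

(** Multiplication by [w] identifies [K] with the colon ideal of [J] by [w], and
    [I] is [J] plus multiples of [w]. *)
Lemma colonP r : C r <-> forall b, I (w * b) -> K (r * b).
Proof.
split=> [Cr b /Cr|rK y /decompose_I[b Iwb Jywb]].
  by rewrite mulrCA; exact: colon_w.
have iJ := J_ideal; rewrite -[y](subrK (w * b)) mulrDr.
apply: idealD => //; first exact: idealMl.
by rewrite mulrCA; apply: wK_sub_J; exact: rK.
Qed.

Lemma ideal_mul_colon_eq : ideal_mul J C = ideal_mul I C.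
Proof.
have iJC := ideal_gen_ideal [set a * b | a in J & b in C].
apply/seteqP; split; apply: ideal_gen_min; try exact: ideal_gen_ideal.
  move=> _ [a Ja [c Cc <-]]; apply: mem_ideal_gen.
  by exists a; [exact: JI | exists c].
move=> _ [y /decompose_I[b Iwb Jywb] [c Cc <-]].
rewrite -[y](subrK (w * b)) mulrDl; apply: (idealD iJC).
  by apply: mem_ideal_gen; exists (y - w * b) => //; exists c.
rewrite -mulrA [b * c]mulrC; apply: wK_sub_JC.
exact: (iffLR (colonP c) Cc).
Qed.

(** * The formula is contained in every reduction *)

(** If [f j + w * b j] lies in [L] for all [j], then [w K] is contained in [L]:
    substituting the relations for [i0] and [i1] into one another shows that
    [w * x i0] is congruent to its multiple by [(x i0 * x i1) ^+ s * b i0 * b i1],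
    an element of [m] because the [b j] are. The remaining [w * x j] then follow,
    being congruent to multiples of [w * x i0]. *)
Lemma wK_sub_of_perturbation L (b : 'I_d -> R) : is_ideal L ->
  (forall j, m (b j)) -> (forall j, L (f j + w * b j)) ->
  forall a, K a -> L (w * a).
Proof.
move=> iL bm Lfb.
have step j : L (w * x j + z j * h j * b j * w).
  rewrite wx; have := idealMl iL (z j * h j) (Lfb j).
  by congr (L _); ring.
have Lwx0 : L (w * x i0).
  have hE : z i0 * h i0 = x i1 * x i1 ^+ s by rewrite /z /h eqxx.
  have hE1 : z i1 * h i1 = x i0 * x i0 ^+ s.
    by rewrite /z /h (negbTE i10) eqxx.
  pose a := x i1 ^+ s * b i0 * (x i0 ^+ s * b i1).
  apply: (@ideal_unit _ m noeth Rlocal L a _ iL).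
    by apply: idealMl => //; apply: idealMl.
  have := idealB iL (step i0) (idealMl iL (x i1 ^+ s * b i0) (step i1)).
  by rewrite hE hE1 /a; congr (L _); ring.
have Lwx1 : L (w * x i1).
  have hE1 : z i1 * h i1 = x i0 * x i0 ^+ s.
    by rewrite /z /h (negbTE i10) eqxx.
  have := idealB iL (step i1) (idealMl iL (x i0 ^+ s * b i1) Lwx0).
  by rewrite hE1; congr (L _); ring.
have Lwx j : L (w * x j).
  have [->//|j0] := eqVneq j i0; have [->//|j1] := eqVneq j i1.
  have := idealB iL (step j) (idealMl iL (h j * b j) Lwx0).
  by rewrite /z (negbTE j0); congr (L _); ring.
move=> a [r ->]; rewrite mulr_sumr; apply: ideal_sum => // j _.
by rewrite mulrCA; exact: idealMl.
Qed.

Lemma JC_sub_of_perturbation L (b : 'I_d -> R) : is_ideal L ->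
  (forall j, I (w * b j)) -> (forall j, L (f j + w * b j)) ->
  ideal_mul J C `<=` L.
Proof.
move=> iL Iwb Lfb.
have LwK := wK_sub_of_perturbation iL (fun j => tc_K_sub_m (Iw_tc (Iwb j))) Lfb.
apply: ideal_gen_min => // _ [_ [r ->] [c Cc <-]].
rewrite mulr_suml; apply: ideal_sum => // j _.
rewrite -mulrA; apply: idealMl => //.
apply: (@ideal_addl _ _ iL _ (w * (c * b j))).
  by apply: LwK; exact: (iffLR (colonP c) Cc).
by have := idealMl iL c (Lfb j); congr (L _); ring.
Qed.

Variables (k : fieldType) (res : {rmorphism R -> k}).
Hypothesis kres : is_residue_field m res.

(** A nonzero relation modulo [m] between the coordinates on the [f j] of the
    generators [l] would prevent [f i] from being in the tight closure of the
    ideal that they generate. Raise the relation to the [q]-th power: since the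
    summands in [w] only contribute coefficients in the Frobenius power of [m],
    and since the entries of syzygies of the [f j ^+ q] lie there too, a fixed
    nonzero multiplier would belong to all Frobenius powers of [m]. *)
Lemma reduction_coordinates_free n (l : 'I_n -> R) (a : 'M[R]_(n, d))
    (b : 'I_n -> R) (v : 'I_d -> R) :
  (forall j, I (w * b j)) ->
  (forall j, l j = \sum_i a j i * f i + w * b j) ->
  (forall i, tc (span xpredT l) (f i)) ->
  (forall j, m (\sum_i a j i * v i)) -> forall i, m (v i).
Proof.
move=> Iwb lE ftc avm i; apply: contrapT => /(local_unit noeth Rlocal)[u uv].
have [c c0 [N cN]] := common_multiplier Rdomain ftc.
suff : z i0 * c = 0 by case/Rdomain => // /z_neq0.
apply: (@frobenius_m_trivial _ N) => e leNe.
set q := (p ^ e)%N; have iM := frob_ideal m e.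
(* Elements having a representation on the [f j ^+ q] that is annihilated, modulo
   the Frobenius power of [m], by the [q]-th power of the relation [v]. *)
pose S : set R := [set y | exists2 r : 'I_d -> R,
  y = \sum_j r j * f j ^+ q & frob m e (\sum_j r j * v j ^+ q)].
have iS : is_ideal [set y | S (z i0 * y)].
  split=> [|y y' [r yr Mr] [r' yr' Mr']|t y [r yr Mr]] /=.
  - exists (fun=> 0); first by rewrite mulr0 big1 // => j _; rewrite mul0r.
    by rewrite big1 => [|j _]; rewrite ?mul0r //; exact: ideal0.
  - exists (fun j => r j + r' j).
      rewrite mulrDr yr yr' -big_split.
      by apply: eq_bigr => j _; rewrite mulrDl.
    have := idealD iM Mr Mr'; rewrite -big_split /=; congr (frob _ _ _).
    by apply: eq_bigr => j _; rewrite mulrDl.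
  - exists (fun j => t * r j).
      by rewrite mulrCA yr mulr_sumr; apply: eq_bigr => j _; rewrite mulrA.
    have := idealMl iM t Mr; rewrite mulr_sumr; congr (frob _ _ _).
    by apply: eq_bigr => j _; rewrite mulrA.
have Sl j : S (z i0 * l j ^+ q).
  have [r rE] := special_combination i0 e (Iw_tc (Iwb j)).
  exists (fun j' => z i0 * a j j' ^+ q + r j' * (z j' ^+ q * h j' ^+ q)).
    rewrite lE exprD_pchar // expr_sum_pchar // mulrDr rE mulr_sumr -big_split.
    by apply: eq_bigr => j' _ /=; rewrite exprMn; ring.
  under eq_bigr do rewrite mulrDl -mulrA -exprMn.
  rewrite big_split -mulr_sumr -expr_sum_pchar //; apply: (idealD iM).
    by apply: (idealMl iM); exact: mem_frobenius_power.
  apply: ideal_sum => // j' _; apply: (idealMr iM); apply: (idealMl iM).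
  by apply: (idealMr iM); exact: mem_frobenius_power.
have : S (z i0 * (c * f i ^+ q)).
  have := cN e leNe i; rewrite frobenius_power_span //.
  by move: (c * _); apply: span_sub.
case=> r rE Mr.
(* Comparing with the obvious representation of [z i0 * c * f i ^+ q] gives a
   syzygy. *)
pose r' j := r j - z i0 * c * (j == i)%:R.
have r'0 : \sum_j r' j * f j ^+ q = 0.
  under eq_bigr do rewrite mulrBl.
  rewrite sumrB -rE mulrA [X in _ - X](bigD1 i) //= eqxx mulr1.
  rewrite big1 ?addr0 ?subrr //.
  by move=> j /negbTE ->; rewrite mulr0 mul0r.
have Mr' j : frob m e (r' j).
  have := syzygy j (expr_pchar_gt0 Rchar e) r'0; apply: span_sub => // j' _.
  by apply: mem_frobenius_power; apply: K_sub_m; apply: J_sub_K; exact: mem_f.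
have -> : z i0 * c = u ^+ q * (z i0 * c * v i ^+ q).
  by rewrite mulrCA -exprMn uv expr1n mulr1.
apply: (idealMl iM).
have -> : z i0 * c * v i ^+ q = \sum_j r j * v j ^+ q - \sum_j r' j * v j ^+ q.
  rewrite -sumrB (bigD1 i) //= big1 ?addr0 /r' ?eqxx => [|j /negbTE ->] /=; ring.
apply: (idealB iM) => //; apply: ideal_sum => // j _; exact: (idealMr iM).
Qed.

(** The coordinates on the [f j] of generators of [L] form a matrix which has a
    left inverse, so that [f j + w * b j] belongs to [L] for suitable [b j]. *)
Lemma JC_sub_reduction L : star_reduction p I L -> ideal_mul J C `<=` L.
Proof.
case=> iL LI tcLI; have [n [l Ll]] := noetherian_span noeth iL.
have Jtc y : J y -> tc L y.
  by move=> Jy; rewrite /tc tcLI; apply: (sub_tight_closure p Rdomain); exact: JI.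
have /choice[b bP] j : exists b, I (w * b) /\ J (l j - w * b).
  have [|b Iwb Jb] := @decompose_I (l j); last by exists b.
  by apply: LI; rewrite Ll; exact: mem_span.
have /choice[a aP] j := (bP j).2.
pose A : 'M[R]_(n, d) := \matrix_(j, i) a j i.
have lE j : l j = \sum_i A j i * f i + w * b j.
  by rewrite -[LHS](subrK (w * b j)) aP; under [in RHS]eq_bigr do rewrite mxE.
have [|[v [i nvi] Av]] := local_left_inverse A noeth Rlocal kres; last first.
  case: nvi; apply: (reduction_coordinates_free (fun j => (bP j).1) lE _ Av) i.
  by move=> i; rewrite -Ll; apply: Jtc; exact: mem_f.
case=> B BA.
apply: (@JC_sub_of_perturbation L (fun i => \sum_j B i j * b j)) => // i.
  rewrite mulr_sumr; apply: ideal_sum => // j _.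
  by rewrite mulrCA; apply: idealMl => //; case: (bP j).
suff -> : f i + w * (\sum_j B i j * b j) = \sum_j B i j * l j.
  apply: ideal_sum => // j _; apply: idealMl => //.
  by rewrite Ll; exact: mem_span.
under [RHS]eq_bigr do rewrite lE mulrDr.
rewrite big_split mulr_sumr /=; congr (_ + _); last first.
  by apply: eq_bigr => j _; rewrite mulrCA.
transitivity (\sum_i' (B *m A) i i' * f i').
  rewrite BA (bigD1 i) //= mxE eqxx mul1r big1 ?addr0 // => i' /negbTE.
  by move=> ii'; rewrite mxE eq_sym ii' mul0r.
transitivity (\sum_i' \sum_j B i j * A j i' * f i').
  by apply: eq_bigr => i' _; rewrite [(B *m A) _ _]mxE mulr_suml.
rewrite exchange_big /=; apply: eq_bigr => j _; rewrite mulr_sumr.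
by apply: eq_bigr => i' _; rewrite mulrA.
Qed.

(** * Enough reductions to cut out the formula *)

Let perturbed i b (j : 'I_d) : R := f j + (j == i)%:R * (w * b).

(** The coefficient of [f i ^+ q] in the expansion of [(w * b) ^+ q] times the
    test element [z i] is again a multiple of [z i], with cofactor in [m] once
    [q] is at least 2; so the perturbation only changes the multiplier of
    [f i ^+ q] by a unit. *)
Lemma perturbed_reduction i b : I (w * b) ->
  star_reduction p I (span xpredT (perturbed i b)).
Proof.
move=> Iwb; set L := span _ _; have iL : is_ideal L by exact: span_ideal.
have LI : L `<=` I.
  apply: span_sub => // j _; apply: idealD => //; last exact: idealMl.
  by apply: JI; exact: mem_f.
split=> //; apply/seteqP; split; first exact: tight_closure_mono.
have Ltc j : tc L (f j).
  have [->|ji] := eqVneq j i; last first.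
    apply: (sub_tight_closure p Rdomain).
    have := mem_span (perturbed i b) (isT : xpredT j).
    by rewrite /perturbed (negbTE ji) mul0r addr0.
  apply/(tight_closureP p Rdomain); exists (z i); first exact: z_neq0.
  exists 1%N => e e_gt0; set q := (p ^ e)%N; have iF := frob_ideal L e.
  have q_gt1 : (1 < q)%N.
    apply: leq_ltn_trans e_gt0 (ltn_expl e _).
    exact: prime_gt1 (pchar_prime Rchar).
  have Fg j' : frob L e (perturbed i b j' ^+ q).
    by apply: mem_frobenius_power; exact: mem_span.
  have Ff j' : j' != i -> frob L e (f j' ^+ q).
    by move=> ji; have := Fg j'; rewrite /perturbed (negbTE ji) mul0r addr0.
  have [r rE] := special_combination i e (Iw_tc Iwb).
  pose a := r i * (z i ^+ q.-1 * h i ^+ q).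
  have zq : z i ^+ q = z i * z i ^+ q.-1 by rewrite -exprS prednK // ltnW.
  apply: (@ideal_unit _ m noeth Rlocal (frob L e) (- a) _ iF).
    apply: idealN => //; apply: idealMl => //; apply: idealMr => //.
    by apply: idealX => //; rewrite -ltnS prednK // ltnW.
  have := idealMl iF (z i) (Fg i).
  rewrite /perturbed eqxx mul1r exprD_pchar // mulrDr rE (bigD1 i) //= addrA.
  move=> Fi; suff -> : (1 - - a) * (z i * f i ^+ q) = z i * f i ^+ q
      + r i * (z i ^+ q * h i ^+ q) * f i ^+ q.
    apply: (ideal_addl iF _ Fi); refine (@ideal_sum _ _ _ _ _ _ iF _) => j' ji.
    by apply: (idealMl iF); exact: Ff.
  by rewrite /a zq; ring.
apply: (tight_closure_trans noeth Rchar Rdomain iI) => y /Itc.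
exact: (tight_closure_span_trans Rchar Rdomain Ltc).
Qed.

(** Let [r i] be a coefficient of an element [y] of [J], determined modulo [J]. If
    [y] also lies in the reduction perturbed at [i] by [w * b], comparison of the
    two expansions shows that [r i * b] lies in [K]. For all [b] with [w * b] in
    [I] together, this says that [r i] lies in [(J : I)]. *)
Lemma star_core_sub_JC : star_core p I `<=` ideal_mul J C.
Proof.
have iJC := ideal_gen_ideal [set a * b | a in J & b in C].
move=> y coreY.
have Jred : star_reduction p I J.
  split; [exact: J_ideal | exact: JI | apply/seteqP; split].
    exact: tight_closure_mono.
  exact: (tight_closure_trans noeth Rchar Rdomain iI).
have [r yr] : J y by exact: coreY.
rewrite yr; apply: ideal_sum => // i _; rewrite mulrC; apply: mem_ideal_gen.
exists (f i); [exact: mem_f | exists (r i) => //].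
apply/colonP => b Iwb; have iK := K_ideal.
have [t yt] : span xpredT (perturbed i b) y.
  by apply: coreY; exact: perturbed_reduction.
have yt' : y = \sum_j t j * f j + w * (t i * b).
  rewrite yt; under eq_bigr do rewrite mulrDr.
  rewrite big_split /=; congr (_ + _); rewrite (bigD1 i) //= eqxx mul1r.
  rewrite big1 ?addr0 1?mulrCA // => j /negbTE ->.
  by rewrite mul0r mulr0.
have [v vE] : K (t i * b).
  apply: colon_w; rewrite -[w * _](addKr (\sum_j t j * f j)) -yt' addrC.
  by apply: idealB; [exact: J_ideal | exists r | exists t].
have := syzygy (q := 1) (r := fun j => t j - r j + v j * (z j * h j)) i isT.
have -> : \sum_j (t j - r j + v j * (z j * h j)) * f j ^+ 1 = 0.
  rewrite -[RHS](subrr y) {1}yt' vE yr mulr_sumr addrAC -sumrB -big_split /=.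
  by apply: eq_bigr => j _; rewrite [w * _]mulrCA wx expr1; ring.
move=> /(_ erefl) Ji; have {}Ji : K (t i - r i + v i * (z i * h i)).
  exact: J_sub_K.
have Kzh : K (v i * (z i * h i)) by apply: idealMl => //; exact: idealMr.
have Ktb : K (t i * b) by exists v.
have := idealB iK Ktb (idealMr iK b (ideal_addl iK Kzh Ji)).
by congr (K _); ring.
Qed.

Theorem star_core_eq : star_core p I = ideal_mul J C.
Proof.
apply/seteqP; split; first exact: star_core_sub_JC.
by move=> y JCy L /JC_sub_reduction; apply.
Qed.

End StarCore.

(** * The formula for the core *)

Theorem theorem3p6 (R : comNzRingType) (m : set R) (p : nat)
    (k : fieldType) (res : {rmorphism R -> k})
    (Rlocal : is_local m) (Rchar : p \in [pchar R])
    (Rexcellent : excellent R) (RCM : cohen_macaulay_local m)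
    (Rnormal : normal_ring R)
    (kres : is_residue_field m res) (kperfect : perfect_field k)
    (d : nat) (d_ge2 : (2 <= d)%N) (x : d.-tuple R)
    (x_param : part_of_system_of_parameters m x)
    (x_test : forall i : 'I_d, (i < 2)%N -> test_ideal p (tnth x i))
    (t : nat) (t_ge2 : (2 <= t)%N)
    (I J : set R) (I_ideal : is_ideal I)
    (J_def : J = ideal_gen [set y | exists i : 'I_d,
               y = if (i < 2)%N then tnth x i ^+ t else tnth x i])
    (J_le_I : J `<=` I) (I_le_Jstar : I `<=` tight_closure p J) :
  star_core p I = ideal_mul J (colon J I) /\
  ideal_mul J (colon J I) = ideal_mul I (colon J I).
Proof.
have noeth : noetherian R by case: Rexcellent.
have Rdomain := normal_local_domain noeth Rlocal Rnormal.
pose i0 : 'I_d := Ordinal (ltnW d_ge2); pose i1 : 'I_d := Ordinal d_ge2.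
have i10 : i1 != i0 by [].
have xm j : m (tnth x j).
  have [s' [_ sub _]] := x_param.
  by apply: sub; rewrite /= mem_cat mem_tnth.
have x_nzd (n : 'I_d -> nat) : (forall j, (0 < n j)%N) -> forall i,
    nzd (span (fun j => j != i) (fun j => tnth x j ^+ n j)) (tnth x i ^+ n i).
  move=> n_gt0 i.
  exact: (parameter_powers_nzd noeth Rlocal Rchar RCM x_param n_gt0).
case: t t_ge2 J_def => [|[|s]] // _ J_def.
have JE : J = span xpredT (fun j : 'I_d =>
    if (j == i0) || (j == i1) then tnth x j ^+ s.+2 else tnth x j).
  rewrite J_def; have small (j : 'I_d) : (j < 2)%N = (j == i0) || (j == i1).
    by rewrite -!val_eqE /=; case: (val j) => [|[|]].
  apply: ideal_gen_span => [j _|y [j ->]]; first by exists j; rewrite small.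
  by exists j => //; rewrite small.
move: J_le_I I_le_Jstar; rewrite JE => J_le_I I_le_Jstar.
have test0 := x_test i0 isT; have test1 := x_test i1 isT.
split; last exact: (ideal_mul_colon_eq i10 x_nzd test0 test1).
exact: (star_core_eq noeth Rlocal Rchar Rdomain i10 xm x_nzd test0 test1 I_ideal
  J_le_I I_le_Jstar kres).
Qed.
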